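(* Let $\alpha_0=\sqrt{1-1/(4\pi^2)}$. For every $\alpha\in(\alpha_0,1]$ there is a constant $c(\alpha)>0$ (depending only on $\alpha-\alpha_0$) such that for all positive integers $d,n$ and all $\delta\in[0,1]$, every $2$-query $(\alpha,\delta)$-approximate LDC of size $n$ and dimension $d$ satisfies $n\ge 2^{c(\alpha)\,\delta d}$.
   Context: For $\vec u\in\mathbb R^d$ nonzero, $\mathsf{weight}_i(\vec u)=|\langle \vec u,\vec e_i\rangle|/\|\vec u\|_2$, where $\vec e_i$ is the $i$-th standard basis vector. A $q$-matching in $[n]$ is a set of pairwise disjoint $q$-element subsets of $[n]$. A $q$-query $(\alpha,\delta)$-approximate LDC of size $n$ and dimension $d$ is a pair $(V,M)$ where $V=\{\vec v_1,\dots,\vec v_n\}$ is a multiset of vectors in $\mathbb R^d$ and $M=(M_1,\dots,M_d)$, each $M_i$ a $q$-matching in $[n]$, such that for every $i\in[d]$ and every $\{j_1,\dots,j_q\}\in M_i$ there is $\vec u\in\mathrm{span}\{\vec v_{j_1},\dots,\vec v_{j_q}\}$ with $\mathsf{weight}_i(\vec u)\ge\alpha$, and $|M_1|+\cdots+|M_d|\ge \delta d n$. *)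

(* Defs.v *)
From HB Require Import structures.
From mathcomp Require Import all_boot all_order all_algebra.
From mathcomp Require Import reals trigo exp.

Set Implicit Arguments.
Unset Strict Implicit.
Unset Printing Implicit Defensive.

Import Order.TTheory GRing.Theory Num.Theory.
Local Open Scope ring_scope.

Definition dotp (R : realType) (d : nat) (u v : 'rV[R]_d) : R :=
  \sum_(k < d) u 0 k * v 0 k.

(* The library's norm on ['rV[R]_d] is the sup norm, hence a separate
   definition of the Euclidean norm. *)
Definition norm2 (R : realType) (d : nat) (u : 'rV[R]_d) : R :=
  Num.sqrt (dotp u u).

(* [delta_mx 0 i] is the [i]-th standard basis row vector. *)
Definition weight (R : realType) (d : nat) (i : 'I_d) (u : 'rV[R]_d) : R :=
  `|dotp u (delta_mx 0 i)| / norm2 u.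

Definition is_qmatching (q n : nat) (P : {set {set 'I_n}}) : Prop :=
  trivIset P /\ (forall A : {set 'I_n}, A \in P -> #|A| = q).

(* The multiset of vectors is the indexed family [v] (repetitions allowed).
   The weight is only meaningful on nonzero vectors, so [u != 0] is required. *)
Definition approx_LDC (R : realType) (q : nat) (alpha delta : R) (n d : nat)
    (v : 'I_n -> 'rV[R]_d) (M : 'I_d -> {set {set 'I_n}}) : Prop :=
  [/\ forall i : 'I_d, is_qmatching q (M i),
      forall (i : 'I_d) (A : {set 'I_n}), A \in M i ->
        exists u : 'rV[R]_d,
          [/\ u \in <<[seq v j | j <- enum A]>>%VS, u != 0 &
              alpha <= weight i u]
    & delta * d%:R * n%:R <= (\sum_(i < d) #|M i|)%:R].

Definition alpha0 (R : realType) : R := Num.sqrt (1 - 1 / (4 * pi ^+ 2)).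

(* Main.v *)
Require Import Defs.
From HB Require Import structures.
From mathcomp Require Import all_boot all_order all_algebra.
From mathcomp Require Import boolp reals sequences topology normedtype derive.
From mathcomp Require Import trigo exp ring lra.

Set Implicit Arguments.
Unset Strict Implicit.
Unset Printing Implicit Defensive.

Import Order.TTheory GRing.Theory Num.Theory.
Import numFieldNormedType.Exports.
Local Open Scope ring_scope.

(** Rescale each vector to [w_a = v_a / <v_a, rho>]. If the plane spanned by [v_a]
    and [v_b] contains a unit vector [u] close to [e_i], then [w_a - w_b] is the
    direction of that plane orthogonal to [rho]; for random [rho] it is, with
    constant probability, within a bounded angle of [u], so that its [i]-th
    coordinate carries a constant fraction of its length. Only the few pairs with
    [v_a], [v_b], [u] parallel escape.

    The differences [w_a - w_b] may have wildly different lengths. For each dyadic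
    scale [s] and coordinate [k] draw a sign [x_(s,k)] and put on the vertex [a]
    the phase [sum_(s,k) x_(s,k) w_a,k / 2^s]. For a pair of direction [i] and
    length about [2^s], the signs of the finer scales can be cancelled once known,
    the coarser ones contribute little, and the remaining phase difference is
    correlated with [x_(s,i)]: the state [sum_a exp(i phase_a) |a>], of dimension
    [n], is a serial quantum random access code for the signs.

    The dimension bound for such a code is obtained as for matrix martingales.
    Step [t] multiplies by [1 + h H_t / 2], with [H_t = lam x_t A_t - 4 lam^2 A_t^2]
    for the signed matching matrix [A_t]. Araki-Lieb-Thirring bounds the average
    trace of the [1/h]-th power of the resulting Gram matrix by the dimension, and
    letting [h] tend to [0] bounds the average of [sum_t <z, H_t z>] by its logarithm.
    The correction [- 4 lam^2 A_t^2] makes the bound linear in the number of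
    matched pairs. *)

(** * A trace inequality of Araki-Lieb-Thirring type *)

Section TraceInequality.
Variables (R : realFieldType) (m : nat).
Implicit Types X Y Z : 'M[R]_m.

Lemma trmxM X Y : (X * Y)^T = Y^T * X^T.
Proof. exact: trmx_mul. Qed.

Lemma trmxX X k : (X ^+ k)^T = X^T ^+ k.
Proof. by elim: k => [|k IH]; rewrite ?expr0 ?trmx1 // exprS trmxM IH -exprSr. Qed.

Lemma mxtraceMC X Y : \tr (X * Y) = \tr (Y * X).
Proof. exact: mxtrace_mulC. Qed.

Lemma mxtrace_mulX X Y k : \tr ((X * Y) ^+ k) = \tr ((Y * X) ^+ k).
Proof.
case: k => [|k]; first by rewrite !expr0.
have XYX j : (X * Y) ^+ j * X = X * (Y * X) ^+ j.
  by elim: j => [|j IH]; rewrite ?mul1r ?mulr1 // exprS -mulrA IH exprS !mulrA.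
by rewrite exprSr mulrA XYX mxtraceMC mulrA -exprS.
Qed.

Lemma mxtrace_gram_ge0 Z : 0 <= \tr (Z * Z^T).
Proof.
rewrite /mxtrace sumr_ge0 // => i _; rewrite mxE sumr_ge0 // => j _.
by rewrite mxE -expr2 sqr_ge0.
Qed.

Lemma mxtrace_sqr_le X : \tr (X * X) <= \tr (X * X^T).
Proof.
have := mxtrace_gram_ge0 (X - X^T).
rewrite linearB /= trmxK mulrBl !mulrBr !raddfB /=.
by rewrite (mxtraceMC X^T X) -trmxM mxtrace_tr; lra.
Qed.

Lemma mxtrace_mul_sym_le X Y : X^T = X -> Y^T = Y ->
  2 * \tr (X * Y) <= \tr (X * X) + \tr (Y * Y).
Proof.
move=> sX sY; have := mxtrace_gram_ge0 (X - Y).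
by rewrite linearB /= sX sY mulrBl !mulrBr !raddfB /= (mxtraceMC Y X); lra.
Qed.

(** The two bounds feed each other. The first at [k.+1] follows from the first at [k] for [Z * Z],
    then the second at [k] for the two Gram matrices of [Z], then AM-GM. The second at [k.+1]
    follows from the first at [k] for [X * Y], cyclicity, and the second at [k] for [X * X] and
    [Y * Y]. *)
Lemma mxtrace_pow2_le k :
  (forall Z, \tr (Z ^+ (2 ^ k.+1)) <= \tr ((Z * Z^T) ^+ (2 ^ k))) /\
  (forall X Y, X^T = X -> Y^T = Y ->
     \tr ((X * Y) ^+ (2 ^ k)) <= \tr (X ^+ (2 ^ k) * Y ^+ (2 ^ k))).
Proof.
elim: k => [|k [IHA IHB]].
  by split=> [Z|X Y _ _]; rewrite ?expn0 ?expn1 ?expr2 ?expr1 // mxtrace_sqr_le.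
split=> [Z|X Y sX sY].
  have -> : Z ^+ (2 ^ k.+2) = (Z * Z) ^+ (2 ^ k.+1).
    by rewrite -expr2 -exprM -expnS.
  apply: le_trans (IHA _) _.
  set Q := Z * Z^T.
  have -> : Z * Z * (Z * Z)^T = Z * (Q * Z^T) by rewrite trmxM !mulrA.
  rewrite mxtrace_mulX -mulrA.
  have sQ : Q^T = Q by rewrite /Q trmxM trmxK.
  have sP : (Z^T * Z)^T = Z^T * Z by rewrite trmxM trmxK.
  apply: le_trans (IHB _ _ sQ sP) _.
  have := @mxtrace_mul_sym_le (Q ^+ (2 ^ k)) ((Z^T * Z) ^+ (2 ^ k)).
  rewrite !trmxX sQ sP => /(_ erefl erefl).
  rewrite -!exprD addnn -mul2n -expnS (mxtrace_mulX Z^T Z) -/Q; lra.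
have -> : \tr (X ^+ (2 ^ k.+1) * Y ^+ (2 ^ k.+1)) =
    \tr ((X * X) ^+ (2 ^ k) * (Y * Y) ^+ (2 ^ k)).
  by rewrite -!expr2 -!exprM -!expnS.
apply: le_trans (IHA _) _.
have -> : X * Y * (X * Y)^T = X * (Y * Y) * X by rewrite trmxM sX sY !mulrA.
rewrite mxtrace_mulX mulrA.
by apply: IHB; rewrite trmxM ?sX ?sY.
Qed.

Lemma mxtrace_ArakiLiebThirring k X Y : X^T = X -> Y^T = Y ->
  \tr ((X * Y) ^+ (2 ^ k)) <= \tr (X ^+ (2 ^ k) * Y ^+ (2 ^ k)).
Proof. exact: (mxtrace_pow2_le k).2. Qed.

End TraceInequality.

(** * Tilted products of random signs *)

Section SignAverage.
Variable R : realFieldType.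

Definition bsign (x : bool) : R := if x then 1 else -1.

Fixpoint avg (T : nat) (F : seq bool -> R) : R :=
  if T is T'.+1 then
    (avg T' (fun xs => F (true :: xs)) + avg T' (fun xs => F (false :: xs))) / 2
  else F [::].

Lemma avg_le T (F G : seq bool -> R) :
  (forall xs, size xs = T -> F xs <= G xs) -> avg T F <= avg T G.
Proof.
elim: T F G => [|T IH] F G FG /=; first exact: FG.
by rewrite ler_pM2r ?invr_gt0 ?ltr0n // lerD // IH // => xs sxs; apply: FG; rewrite /= sxs.
Qed.

Lemma eq_avg T (F G : seq bool -> R) :
  (forall xs, size xs = T -> F xs = G xs) -> avg T F = avg T G.
Proof.
by move=> FG; apply/eqP; rewrite eq_le !avg_le // => xs /FG ->.
Qed.

Lemma avgD T (F G : seq bool -> R) :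
  avg T (fun xs => F xs + G xs) = avg T F + avg T G.
Proof. by elim: T F G => [|T IH] F G //=; rewrite !IH; field. Qed.

Lemma avgZ T c (F : seq bool -> R) : avg T (fun xs => c * F xs) = c * avg T F.
Proof. by elim: T F => [|T IH] F //=; rewrite !IH; field. Qed.

Lemma avg_cst T c : avg T (fun=> c) = c.
Proof. by elim: T => [|T IH] //=; rewrite !IH; field. Qed.

Lemma avg_sum T (I : Type) (r : seq I) (P : pred I) (F : I -> seq bool -> R) :
  avg T (fun xs => \sum_(i <- r | P i) F i xs) = \sum_(i <- r | P i) avg T (F i).
Proof.
elim: r => [|i r IH]; first by under eq_avg do rewrite big_nil; rewrite avg_cst big_nil.
under eq_avg do rewrite big_cons.
rewrite big_cons; case: (P i) => //; by rewrite avgD IH.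
Qed.

Lemma avg_sqr_le T (F : seq bool -> R) : avg T F ^+ 2 <= avg T (fun xs => F xs ^+ 2).
Proof.
elim: T F => [|T IH] F //=.
have /= h1 := IH (fun xs => F (true :: xs)).
have /= h2 := IH (fun xs => F (false :: xs)).
set a := avg T (fun xs => F (true :: xs)) in h1 *.
set b := avg T (fun xs => F (false :: xs)) in h2 *.
by have := sqr_ge0 (a - b); lra.
Qed.

Lemma avg_pow2_le T k (F : seq bool -> R) :
  avg T F ^+ (2 ^ k) <= avg T (fun xs => F xs ^+ (2 ^ k)).
Proof.
elim: k F => [|k IH] F; first by rewrite expr1.
rewrite expnS exprM; apply: le_trans (_ : _ <= avg T (fun xs => F xs ^+ 2) ^+ (2 ^ k)) _.
  rewrite lerXn2r ?avg_sqr_le // nnegrE ?sqr_ge0 //.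
  exact: le_trans (sqr_ge0 _) (avg_sqr_le _ _).
by apply: le_trans (IH _) _; apply: avg_le => xs _; rewrite exprM.
Qed.

End SignAverage.

Section Tilt.
Variables (R : realType) (m : nat).
Implicit Types A X : 'M[R]_m.

(** For symmetric [A] with [A ^+ 3 = A], this acts as [c + s] and [c - s] on the eigenspaces of 1
    and -1, and as 1 on the kernel. *)
Definition tripotent A c s : 'M[R]_m := 1 + (c - 1) *: (A * A) + s *: A.

Lemma tripotentM A c s c' s' : A * A * A = A ->
  tripotent A c s * tripotent A c' s' = tripotent A (c * c' + s * s') (c * s' + s * c').
Proof.
move=> A3; rewrite /tripotent.
have A3' : A * (A * A) = A by rewrite mulrA.
have A4 : A * A * (A * A) = A * A by rewrite mulrA A3.
have Zl a X Y : (a *: X) * Y = a *: (X * Y) by symmetry; apply: scalemxAl.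
have Zr a X Y : X * (a *: Y) = a *: (X * Y) by symmetry; apply: scalemxAr.
rewrite !mulrDl !mulrDr !Zl !Zr !mul1r !mulr1 A3 A3' A4.
set P := A * A.
by apply/matrixP => i j; rewrite !mxE; ring.
Qed.

Lemma tripotentX A p q k : A * A * A = A ->
  tripotent A ((p + q) / 2) ((p - q) / 2) ^+ k =
  tripotent A ((p ^+ k + q ^+ k) / 2) ((p ^+ k - q ^+ k) / 2).
Proof.
move=> A3; elim: k => [|k IH].
  rewrite !expr0 /tripotent; set P := A * A.
  by apply/matrixP => i j; rewrite !mxE; field.
by rewrite exprS IH tripotentM //; congr tripotent; rewrite !exprS; field.
Qed.

(* The second-order correction [- 4 lam^2 A^2] makes the average of
   [exp (drift true)] and [exp (drift false)] at most the identity. *)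
Definition drift (lam : R) (x : bool) A : 'M[R]_m :=
  (bsign R x * lam) *: A - (4 * lam ^+ 2) *: (A * A).

Definition tilt (lam h : R) (x : bool) A : 'M[R]_m := 1 + (h / 2) *: drift lam x A.

Lemma tiltE lam h x A : tilt lam h x A =
  tripotent A (1 - h / 2 * (4 * lam ^+ 2)) (h / 2 * (bsign R x * lam)).
Proof.
rewrite /tilt /drift /tripotent; set P := A * A.
by apply/matrixP => i j; rewrite !mxE; ring.
Qed.

Lemma tilt_sym lam h x A : A^T = A -> (tilt lam h x A)^T = tilt lam h x A.
Proof.
by move=> sA; rewrite tiltE /tripotent !linearD /= !linearZ /= trmx1 trmxM sA.
Qed.

(** The left side is at most [expR y <= 1 / (1 - y)], and [(1 - y) * (1 + y + 2 * y ^+ 2) = 1 + y ^+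
    2 * (1 - 2 * y)]. The lower bound on [y] keeps the base nonnegative. *)
Lemma expr1D_div_le (y : R) (k : nat) : (0 < k)%N -> y <= 1 / 2 -> - k%:R <= y ->
  (1 + y / k%:R) ^+ k <= 1 + y + 2 * y ^+ 2.
Proof.
move=> k0 y1 yk.
have k0' : (0 : R) < k%:R by rewrite ltr0n.
apply: le_trans (_ : _ <= expR (y / k%:R) ^+ k) _.
  rewrite lerXn2r // ?nnegrE ?expR_ge0 ?expR_ge1Dx //.
  have : -1 <= y / k%:R by rewrite ler_pdivlMr // mulN1r.
  lra.
rewrite -expRM_natl mulrCA divff ?mulr1 ?gt_eqF //.
have h : (1 - y) * expR y <= 1.
  rewrite -[leRHS](expRxMexpNx_1 y) mulrC ler_wpM2l ?expR_ge0 //.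
  have := expR_ge1Dx (- y); lra.
have : 1 <= (1 - y) * (1 + y + 2 * y ^+ 2).
  have : 0 <= y ^+ 2 * (1 - 2 * y) by rewrite mulr_ge0 ?sqr_ge0 //; lra.
  lra.
move=> h2; rewrite -(@ler_pM2l _ (1 - y)); first exact: le_trans h h2.
lra.
Qed.

(** Araki-Lieb-Thirring separates [X ^+ N] from the power [2 * N] of the tilt. Averaging over the
    sign cancels the part odd in [A] and leaves [1 - (1 - c) *: (A * A)] with [c <= 1]; since [N] is
    even, the trace of [X ^+ N * (A * A)] is that of a Gram matrix. *)
Lemma tilt_avg_le lam h A X k : (0 < k)%N -> h = ((2 ^ k)%:R)^-1 -> 0 <= lam <= 1 / 4 ->
  X^T = X -> A^T = A -> A * A * A = A ->
  (\tr ((tilt lam h true A * X * tilt lam h true A) ^+ (2 ^ k)) +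
   \tr ((tilt lam h false A * X * tilt lam h false A) ^+ (2 ^ k))) / 2
  <= \tr (X ^+ (2 ^ k)).
Proof.
case: k => // k _ hE /andP[l0 l1] sX sA A3.
set N := (2 ^ k.+1)%N.
have N0 : (0 < N)%N by rewrite expn_gt0.
have N0' : (0 : R) < N%:R by rewrite ltr0n.
have NN : N%:R != 0 :> R by rewrite gt_eqF.
have step x : \tr ((tilt lam h x A * X * tilt lam h x A) ^+ N) <=
    \tr (X ^+ N * tilt lam h x A ^+ (2 * N)).
  have -> : tilt lam h x A * X * tilt lam h x A =
      tilt lam h x A * (X * tilt lam h x A) by rewrite mulrA.
  rewrite mxtrace_mulX -mulrA exprM expr2.
  by apply: mxtrace_ArakiLiebThirring => //; rewrite trmxM tilt_sym.
(* [p] and [q] are the values of the tilt with sign [true] at the eigenvalues 1 and -1 of [A]; the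
   sign [false] exchanges them. *)
set p := 1 + (lam - 4 * lam ^+ 2) / (2 * N)%:R.
set q := 1 + (- lam - 4 * lam ^+ 2) / (2 * N)%:R.
have tE x : tilt lam h x A ^+ (2 * N) = tripotent A ((p ^+ (2 * N) + q ^+ (2 * N)) / 2)
   (bsign R x * ((p ^+ (2 * N) - q ^+ (2 * N)) / 2)).
  rewrite tiltE; case: x.
    rewrite mul1r mul1r -tripotentX //; congr (tripotent _ _ _ ^+ _);
      by rewrite /p /q hE -/N natrM; field.
  have -> : bsign R false * ((p ^+ (2 * N) - q ^+ (2 * N)) / 2) =
      (q ^+ (2 * N) - p ^+ (2 * N)) / 2 by rewrite /bsign; field.
  rewrite [p ^+ _ + _]addrC -tripotentX // /bsign; congr (tripotent _ _ _ ^+ _);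
    by rewrite /p /q hE -/N natrM; field.
have N2 : (0 < 2 * N)%N by rewrite muln_gt0.
have N2' : (2 : R) <= (2 * N)%:R by rewrite ler_nat leq_pmulr.
have l2 : lam ^+ 2 <= 1 / 4 * lam by rewrite expr2 ler_wpM2r.
have l2' : 0 <= lam ^+ 2 by rewrite sqr_ge0.
have pb : p ^+ (2 * N) <= 1 + (lam - 4 * lam ^+ 2) + 2 * (lam - 4 * lam ^+ 2) ^+ 2.
  by apply: expr1D_div_le => //; lra.
have qb : q ^+ (2 * N) <= 1 + (- lam - 4 * lam ^+ 2) + 2 * (- lam - 4 * lam ^+ 2) ^+ 2.
  by apply: expr1D_div_le => //; lra.
set c := (p ^+ (2 * N) + q ^+ (2 * N)) / 2 in tE.
(* The bounds on [p] and [q] give [c <= 1 - 2 * lam ^+ 2 + 32 * lam ^+ 4], which is at most 1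
   exactly when [lam ^+ 2 <= 1 / 16]. *)
have c1 : c <= 1.
  have l4 : lam ^+ 2 * lam ^+ 2 <= 1 / 16 * lam ^+ 2.
    by rewrite ler_wpM2r //; lra.
  rewrite /c; nra.
apply: le_trans (_ : (\tr (X ^+ N * tilt lam h true A ^+ (2 * N)) +
   \tr (X ^+ N * tilt lam h false A ^+ (2 * N))) / 2 <= _).
  by rewrite ler_pM2r ?invr_gt0 ?ltr0n // lerD.
rewrite !tE -mxtraceD -mulrDr.
set s := (_ - _) / 2.
have -> : tripotent A c (bsign R true * s) + tripotent A c (bsign R false * s) =
   2 *: (1 - (1 - c) *: (A * A)).
  rewrite /tripotent /bsign; set P := A * A.
  by apply/matrixP => i j; rewrite !mxE; ring.
have Zr a (Y Z : 'M[R]_m) : Y * (a *: Z) = a *: (Y * Z) by symmetry; apply: scalemxAr.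
rewrite Zr mulrBr Zr mulr1 mxtraceZ raddfB /= mxtraceZ.
suff : 0 <= \tr (X ^+ N * (A * A)).
  move=> h0; have : 0 <= (1 - c) * \tr (X ^+ N * (A * A)) by rewrite mulr_ge0 // subr_ge0.
  lra.
have := mxtrace_gram_ge0 (A * X ^+ (2 ^ k)).
rewrite trmxM trmxX sX sA -mulrA mxtraceMC -!mulrA mulrA.
by rewrite -exprD addnn -mul2n -expnS.
Qed.

End Tilt.

(** * Polynomials near zero and their first-order coefficient *)

Section PolyNearZero.
Variable R : realFieldType.
Implicit Types (p q : {poly R}) (t h : R).

Lemma horner_bounded p : exists2 B, 0 < B & forall t, 0 <= t <= 1 -> `|p.[t]| <= B.
Proof.
exists (1 + \sum_(i < size p) `|p`_i|).
  by rewrite ltr_pwDl // sumr_ge0 // => i _; rewrite normr_ge0.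
move=> t /andP[t0 t1]; rewrite horner_coef.
apply: le_trans (ler_norm_sum _ _ _) _.
apply: le_trans (_ : \sum_(i < size p) `|p`_i| <= _); last by rewrite lerDr ler01.
apply: ler_sum => i _; rewrite normrM normrX (ger0_norm t0).
by rewrite ler_piMr ?normr_ge0 // exprn_ile1.
Qed.

Lemma horner_gt0_near0 p : 0 < p`_0 ->
  exists2 e, 0 < e & forall t, 0 <= t <= e -> 0 < p.[t].
Proof.
move=> p0.
have [q ->] : exists q, p = (p`_0)%:P + q * 'X.
  exists (drop_poly 1 p); apply/polyP => i.
  rewrite coefD coefC coefMX coef_drop_poly; case: i => [|i] /=; first by rewrite addr0.
  by rewrite add0r addn1.
have [B B0 Bq] := horner_bounded q.
set c := p`_0 in p0 *.
have cB : 0 < c / (2 * B) by rewrite divr_gt0 // mulr_gt0.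
exists (Num.min 1 (c / (2 * B))); first by rewrite lt_min ltr01 cB.
move=> t /andP[t0]; rewrite le_min => /andP[t1 tB].
have t01 : 0 <= t <= 1 by rewrite t0.
rewrite hornerD hornerC hornerM hornerX.
have := Bq _ t01; rewrite ler_norml => /andP[hB _].
have h1 : - B * t <= q.[t] * t by rewrite ler_wpM2r.
have h2 : t * (2 * B) <= c by rewrite -ler_pdivlMr // mulr_gt0.
lra.
Qed.

Lemma horner_neq0_near0 p : p != 0 ->
  exists2 e, 0 < e & forall t, 0 < t <= e -> p.[t] != 0.
Proof.
elim/poly_ind: p => [|p c IH]; first by rewrite eqxx.
have [->|c0 _] := eqVneq c 0.
  rewrite addr0 mulf_eq0 polyX_eq0 orbF => /IH [e e0 he]; exists e => // t te.
  by rewrite hornerM hornerX mulf_neq0 ?he //; case/andP: te => /gt_eqF ->.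
have [|e e0 he] := @horner_gt0_near0 ((p * 'X + c%:P) * (p * 'X + c%:P)).
  by rewrite coef0M coefD coefMX coefC /= add0r -expr2 lt_def sqr_ge0 sqrf_eq0 c0.
exists e => // t /andP[t0 te]; have := he t; rewrite hornerM (ltW t0) te => /(_ isT).
by apply: contraTneq => ->; rewrite mulr0 ltxx.
Qed.

Lemma near0_and (P Q : R -> Prop) :
  (exists2 e, 0 < e & forall t, 0 < t <= e -> P t) ->
  (exists2 e, 0 < e & forall t, 0 < t <= e -> Q t) ->
  exists2 e, 0 < e & forall t, 0 < t <= e -> P t /\ Q t.
Proof.
move=> [e e0 he] [f f0 hf]; exists (Num.min e f); first by rewrite lt_min e0.
by move=> t; rewrite le_min => /and3P[t0 te tf]; split; [apply: he | apply: hf]; rewrite t0.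
Qed.

Lemma near0_all (I : eqType) (r : seq I) (P : I -> R -> Prop) :
  (forall i, i \in r -> exists2 e, 0 < e & forall t, 0 < t <= e -> P i t) ->
  exists2 e, 0 < e & forall t, 0 < t <= e -> forall i, i \in r -> P i t.
Proof.
elim: r => [|i r IH] h; first by exists 1.
have [||e e0 he] := @near0_and (P i) (fun t => forall i, i \in r -> P i t).
- by apply: h; rewrite mem_head.
- by apply: IH => j jr; apply: h; rewrite inE jr orbT.
exists e => // t te j; rewrite inE => /predU1P[->|]; first by case: (he t te).
by case: (he t te) => _; apply.
Qed.

End PolyNearZero.

Lemma coef1_le_ln (R : realType) (p : {poly R}) (L : R) : 1 <= L ->
  p`_0 = 1 ->
  (forall k, (0 < k)%N -> p.[((2 ^ k)%:R)^-1] ^+ (2 ^ k) <= L) ->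
  p`_1 <= 4 * ln L.
Proof.
move=> L1 p0 hp; have [D0|D0] := leP p`_1 0.
  by apply: le_trans D0 _; rewrite mulr_ge0 // ln_ge0.
set D := p`_1 in D0 *.
have [q pE] : exists q, p = 1%:P + q * 'X.
  exists (drop_poly 1 p); apply/polyP => i.
  rewrite coefD coefC coefMX coef_drop_poly; case: i => [|i] /=; first by rewrite addr0.
  by rewrite add0r addn1.
have q0 : q`_0 = D by rewrite /D pE coefD coefC coefMX /= add0r.
have [|e e0 he] := @horner_gt0_near0 _ (q - (D / 2)%:P).
  by rewrite coefB coefC q0 /=; lra.
(* [N > e^-1] puts [1 / N] in the range where [q] exceeds [D / 2]; [N > D] gives [y <= 1]. *)
pose M := Num.max e^-1 D.
have [k kM] : exists k, M < (2 ^ k)%:R.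
  exists (Num.Def.truncn M).+1; apply: lt_le_trans (truncnS_gt M) _.
  by rewrite ler_nat ltnW // ltn_expl.
have {}kM : M < (2 ^ k.+1)%:R.
  by apply: lt_trans kM _; rewrite ltr_nat ltn_exp2l.
set N := (2 ^ k.+1)%N in kM.
have N0 : (0 : R) < N%:R by rewrite ltr0n expn_gt0.
move: kM; rewrite gt_max => /andP[eN DN].
have hN : 0 <= (N%:R : R)^-1 <= e.
  by rewrite invr_ge0 (ltW N0) /= -[e]invrK lef_pV2 ?posrE ?invr_gt0 // ltW.
have := he _ hN; rewrite hornerD hornerN hornerC subr_gt0 => qN.
pose y := D / 2 / N%:R.
have y0 : 0 < y by rewrite !divr_gt0.
have y1 : y <= 1 by rewrite /y ler_pdivrMr //; lra.
have pN : 1 + y <= p.[(N%:R)^-1].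
  by rewrite pE hornerD hornerM hornerX hornerC lerD2l /y ler_pM2r ?invr_gt0 // ltW.
have pN0 : 0 < 1 + y by lra.
have h1 : (1 + y) ^+ N <= L.
  apply: le_trans (hp k.+1 isT); rewrite lerXn2r // nnegrE; lra.
have h2 : ln (1 + y) *+ N <= ln L.
  by rewrite -lnXn // ler_ln ?posrE ?exprn_gt0 //; lra.
have h3 : y / 2 <= ln (1 + y).
  have : ln (1 + - (y / (1 + y))) <= - (y / (1 + y)).
    apply: le_ln1Dx; rewrite ltrN2 ltr_pdivrMr //; lra.
  have -> : 1 + - (y / (1 + y)) = (1 + y)^-1 by field; lra.
  rewrite lnV ?posrE // lerN2 => h; apply: le_trans h.
  by rewrite ler_pM2l // lef_pV2 ?posrE //; lra.
have h4 : N%:R * (y / 2) <= ln L.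
  by apply: le_trans h2; rewrite -[ln _ *+ _]mulr_natl ler_pM2l.
have : N%:R * (y / 2) = D / 4 by rewrite /y; field; lra.
lra.
Qed.

(** * Cauchy-Schwarz and quadratic forms *)

Lemma sum_mul_sqr_le (R : realFieldType) (I : finType) (a b : I -> R) :
  (\sum_i a i * b i) ^+ 2 <= (\sum_i a i ^+ 2) * (\sum_i b i ^+ 2).
Proof.
set A := \sum_i a i ^+ 2; set B := \sum_i b i ^+ 2; set C := \sum_i a i * b i.
have A0 : 0 <= A by rewrite sumr_ge0 // => i _; rewrite sqr_ge0.
have h : 0 <= A * (A * B - C ^+ 2).
  have <- : \sum_i (A * b i - C * a i) ^+ 2 = A * (A * B - C ^+ 2).
    rewrite (eq_bigr (fun i => A ^+ 2 * b i ^+ 2 - 2 * A * C * (a i * b i) +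
      C ^+ 2 * a i ^+ 2)) => [|i _]; last by ring.
    by rewrite big_split /= sumrB -!mulr_sumr -/A -/B -/C; ring.
  by rewrite sumr_ge0 // => i _; rewrite sqr_ge0.
move: A0; rewrite le0r => /orP[/eqP A0|A0].
  suff -> : C = 0 by rewrite expr0n /= A0 mul0r.
  rewrite /C big1 // => i _.
  have /eqP := A0; rewrite /A psumr_eq0 => [|j _]; last exact: sqr_ge0.
  by move/allP/(_ i (mem_index_enum _)); rewrite sqrf_eq0 => /eqP ->; rewrite mul0r.
by rewrite -subr_ge0 -(pmulr_rge0 _ A0).
Qed.

Section QuadraticForm.
Variables (R : realFieldType) (m : nat).
Implicit Types (X : 'M[R]_m) (f : 'cV[R]_m).

Definition quad X f : R := (f^T *m X *m f) 0 0.
Definition sqnorm f : R := (f^T *m f) 0 0.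

Lemma sqnormE f : sqnorm f = \sum_i f i 0 ^+ 2.
Proof. by rewrite /sqnorm mxE; apply: eq_bigr => i _; rewrite mxE expr2. Qed.

Lemma sqnorm_ge0 f : 0 <= sqnorm f.
Proof. by rewrite sqnormE sumr_ge0 // => i _; rewrite sqr_ge0. Qed.

Lemma quad_sym_sqr X f : X^T = X -> quad (X * X) f = sqnorm (X *m f).
Proof. by move=> sX; rewrite /quad /sqnorm trmx_mul sX !mulmxA. Qed.

Lemma quad_sqr_le X f : X^T = X -> quad X f ^+ 2 <= sqnorm f * quad (X * X) f.
Proof.
move=> sX; rewrite quad_sym_sqr // !sqnormE.
rewrite /quad -mulmxA mxE; under eq_bigr do rewrite mxE.
exact: sum_mul_sqr_le.
Qed.

Lemma sqnorm_mul_le X f : sqnorm (X *m f) <= sqnorm f * \tr (X * X^T).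
Proof.
rewrite sqnormE /mxtrace mulr_sumr; apply: ler_sum => i _.
rewrite !mxE mulrC sqnormE.
under [X in _ <= X * _]eq_bigr do rewrite mxE -expr2.
exact: sum_mul_sqr_le.
Qed.

(** Jensen's inequality for the spectral measure of [X] at [f], obtained without diagonalising by
    iterating Cauchy-Schwarz along [X], [X * X] and so on. *)
Lemma quad_pow2_le X f k : X^T = X ->
  quad X f ^+ (2 ^ k) * sqnorm f <= sqnorm f ^+ (2 ^ k) * quad (X ^+ (2 ^ k)) f.
Proof.
elim: k X => [|k IH] X sX; first by rewrite !expr1 mulrC.
rewrite expnS !exprM expr2.
have h := IH (X * X); rewrite trmxM sX in h.
apply: le_trans (_ : sqnorm f ^+ (2 ^ k) * (quad (X * X) f ^+ (2 ^ k) * sqnorm f) <= _).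
  rewrite mulrA -exprMn ler_wpM2r ?sqnorm_ge0 // -expr2 lerXn2r ?quad_sqr_le // nnegrE.
    by rewrite sqr_ge0.
  by rewrite mulr_ge0 ?quad_sym_sqr ?sqnorm_ge0.
apply: le_trans (ler_wpM2l _ (h erefl)) _; first by rewrite exprn_ge0 ?sqnorm_ge0.
by rewrite mulrA exprMn expr2.
Qed.

Lemma quad_pow2_trace_le X f k : (0 < k)%N -> X^T = X -> 0 < sqnorm f ->
  quad X f ^+ (2 ^ k) <= sqnorm f ^+ (2 ^ k) * \tr (X ^+ (2 ^ k)).
Proof.
case: k => // k _ sX f0.
rewrite -(ler_pM2r f0); apply: le_trans (quad_pow2_le f k.+1 sX) _.
rewrite -mulrA ler_wpM2l ?exprn_ge0 ?sqnorm_ge0 //.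
rewrite expnS mul2n -addnn exprD quad_sym_sqr ?trmxX ?sX // [leRHS]mulrC.
by apply: le_trans (sqnorm_mul_le _ _) _; rewrite trmxX sX.
Qed.

End QuadraticForm.

(** The factor 1/2 compensates the two equal cross terms, so that the coefficient of ['X] is the
    quadratic form of [H] itself. *)
Lemma sqnorm_half_perturb (R : realFieldType) m (Q : 'cV[{poly R}]_m) (H : 'M[{poly R}]_m) :
  H^T = H -> let P := Q + ('X * (1 / 2)%:P) *: (H *m Q) in
  (P^T *m P) 0 0 = (Q^T *m Q) 0 0 + (Q^T *m H *m Q) 0 0 * 'X
    + (1 / 4)%:P * (Q^T *m H *m H *m Q) 0 0 * 'X * 'X.
Proof.
move=> sH P.
have -> : P^T = Q^T + ('X * (1 / 2)%:P) *: (Q^T *m H).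
  by rewrite -[in RHS]sH -trmx_mul; apply/matrixP => i j; rewrite !mxE.
rewrite /P mulmxDl !mulmxDr.
rewrite -!scalemxAl -!scalemxAr !mulmxA scalerA.
have E (a b d : 'M[{poly R}]_1) (c c' : {poly R}) :
    (a + c *: b + (c *: b + c' *: d)) 0 0 = a 0 0 + c * b 0 0 + (c * b 0 0 + c' * d 0 0).
  by rewrite !mxE.
rewrite E; set a := (_ *m _) 0 0; set b := (_ *m _) 0 0; set d := (_ *m _) 0 0.
have -> : (1 / 4)%:P = (1 / 2)%:P * (1 / 2)%:P :> {poly R} by rewrite -polyCM; congr polyC; field.
have h2 : (1 / 2)%:P + (1 / 2)%:P = 1 :> {poly R} by rewrite -polyCD -polyC1; congr polyC; field.
by rewrite -[b * 'X]mul1r -h2; ring.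
Qed.

(** * Random products of tilts and rotations *)

Section RandomProduct.
Variables (R : realType) (m : nat) (I : Type).
Variables (A : I -> 'M[R]_m) (O : I -> bool -> 'M[R]_m) (lam : R) (e : 'cV[R]_m).
Hypothesis sA : forall i, (A i)^T = A i.
Hypothesis A3 : forall i, A i * A i * A i = A i.
Hypothesis orthO : forall i x, (O i x)^T * O i x = 1.
Hypothesis lam_bound : 0 <= lam <= 1 / 4.
Hypothesis e_gt0 : 0 < sqnorm e.

Fixpoint wprod (h : R) (l : seq I) (xs : seq bool) : 'M[R]_m :=
  match l, xs with
  | i :: l', x :: xs' => tilt lam h x (A i) * O i x * wprod h l' xs'
  | _, _ => 1
  end.

Fixpoint zvec (l : seq I) (xs : seq bool) : 'cV[R]_m :=
  match l, xs with
  | i :: l', x :: xs' => O i x *m zvec l' xs'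
  | _, _ => e
  end.

(** The derivative at [h = 0] of the squared norm of [wprod h l xs *m e]; see [wprod_poly]. *)
Fixpoint gain (l : seq I) (xs : seq bool) : R :=
  match l, xs with
  | i :: l', x :: xs' => quad (drift lam x (A i)) (zvec l xs) + gain l' xs'
  | _, _ => 0
  end.

(** The first sign is fixed while the later ones are averaged by induction, with [X] replaced by its
    conjugate under the first factor. The rotation, which may depend on that sign, then drops out of
    the trace by orthogonality, and [tilt_avg_le] averages over the first sign. *)
Lemma wprod_avg_le k h l (X : 'M[R]_m) :
  (0 < k)%N -> h = ((2 ^ k)%:R)^-1 -> X^T = X ->
  avg (size l) (fun xs => \tr (((wprod h l xs)^T * X * wprod h l xs) ^+ (2 ^ k)))
  <= \tr (X ^+ (2 ^ k)).
Proof.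
move=> k0 hE; elim: l X => [|i l IH] X sX /=.
  by rewrite trmx1 mul1r mulr1.
apply: le_trans (tilt_avg_le k0 hE lam_bound sX (sA i) (A3 i)).
rewrite ler_pM2r ?invr_gt0 ?ltr0n //.
have step x : avg (size l) (fun xs => \tr (((tilt lam h x (A i) * O i x * wprod h l xs)^T
    * X * (tilt lam h x (A i) * O i x * wprod h l xs)) ^+ (2 ^ k))) <=
  \tr ((tilt lam h x (A i) * X * tilt lam h x (A i)) ^+ (2 ^ k)).
  have sG := tilt_sym lam h x (sA i).
  set G := tilt lam h x (A i) in sG *.
  have := IH ((O i x)^T * (G * X * G) * O i x).
  rewrite !trmxM !trmxK sX sG !mulrA => /(_ erefl) h1.
  apply: le_trans (_ : _ <= \tr (((O i x)^T * (G * X * G * O i x)) ^+ (2 ^ k))) _; last first.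
    rewrite mxtrace_mulX -(mulrA _ (O i x)) (_ : O i x * (O i x)^T = 1) ?mulr1 //.
    exact: (mulmx1C (orthO i x)).
  rewrite !mulrA; apply: le_trans h1; apply: avg_le => xs _.
  by rewrite !trmxM sG !mulrA.
by rewrite lerD.
Qed.

(** For fixed signs the product is polynomial in [h], so differentiation at 0 becomes reading off a
    coefficient. The tilts are the identity at [h = 0], where only the rotations remain. *)
Lemma wprod_poly l xs : exists P : 'cV[{poly R}]_m,
  [/\ forall h, map_mx (horner_eval h) P = wprod h l xs *m e,
      map_mx (horner_eval 0) P = zvec l xs,
      ((P^T *m P) 0 0)`_0 = sqnorm e &
      ((P^T *m P) 0 0)`_1 = gain l xs].
Proof.
have base : exists P : 'cV[{poly R}]_m,
  [/\ forall h, map_mx (horner_eval h) P = 1 *m e,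
      map_mx (horner_eval 0) P = e, ((P^T *m P) 0 0)`_0 = sqnorm e &
      ((P^T *m P) 0 0)`_1 = 0].
  exists (map_mx polyC e); split.
  - by move=> h; rewrite mul1mx -map_mx_comp; apply/matrixP => i j; rewrite !mxE /= /horner_eval hornerC.
  - by rewrite -map_mx_comp; apply/matrixP => i j; rewrite !mxE /= /horner_eval hornerC.
  - by rewrite map_trmx -map_mxM mxE coefC.
  - by rewrite map_trmx -map_mxM mxE coefC.
elim: l xs => [|i l IH] [|x xs] //=.
have [P [Ph Pz P0 P1]] := IH xs.
set Q := map_mx polyC (O i x) *m P.
set H := drift lam x (A i); set Hp := map_mx polyC H.
set c : {poly R} := 'X * (1 / 2)%:P.
have Qh h : map_mx (horner_eval h) Q = O i x *m map_mx (horner_eval h) P.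
  rewrite map_mxM -map_mx_comp; congr (_ *m _).
  by apply/matrixP => a b; rewrite !mxE /= /horner_eval hornerC.
have Hh h : map_mx (horner_eval h) Hp = H.
  by rewrite -map_mx_comp; apply/matrixP => a b; rewrite !mxE /= /horner_eval hornerC.
have ch h : horner_eval h c = h / 2.
  by rewrite /horner_eval /c hornerM hornerX hornerC mul1r.
have sH : Hp^T = Hp.
  rewrite /Hp map_trmx /H /drift; congr map_mx.
  by rewrite raddfB /= !linearZ /= trmxM sA.
have QQ : Q^T *m Q = P^T *m P.
  rewrite /Q trmx_mul -mulmxA (mulmxA _ (map_mx _ _)) map_trmx -map_mxM.
  by rewrite [(O i x)^T *m _](orthO i x) map_mx1 mul1mx.
have alg (a : R) (B : 'M[R]_m) (z : 'cV[R]_m) : z + a *: (B *m z) = (1 + a *: B) *m z.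
  by rewrite mulmxDl -scalemxAl [1 *m z]mul1mx.
have Ph' h : map_mx (horner_eval h) (Q + c *: (Hp *m Q)) =
    (tilt lam h x (A i) * O i x * wprod h l xs) *m e.
  rewrite map_mxD map_mxZ map_mxM Hh Qh [X in X *: _](ch h) Ph /tilt -/H.
  by rewrite -!mulmxE -!mulmxA alg.
exists (Q + c *: (Hp *m Q)).
have QHQ : ((Q^T *m Hp *m Q) 0 0)`_0 = quad H (O i x *m zvec l xs).
  have -> : ((Q^T *m Hp *m Q) 0 0)`_0 = (map_mx (horner_eval 0) (Q^T *m Hp *m Q)) 0 0.
    by rewrite [in RHS]mxE /horner_eval horner_coef0.
  by rewrite 2!map_mxM -map_trmx Hh Qh Pz.
have E : ((Q + c *: (Hp *m Q))^T *m (Q + c *: (Hp *m Q))) 0 0 =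
    (P^T *m P) 0 0 + (Q^T *m Hp *m Q) 0 0 * 'X
    + (1 / 4)%:P * (Q^T *m Hp *m Hp *m Q) 0 0 * 'X * 'X.
  by rewrite sqnorm_half_perturb // QQ.
split => //.
- by rewrite Ph' -Pz Ph /tilt mul0r scale0r addr0 mul1r mulmxA.
- by rewrite E !coefD !coefMX /= !addr0.
- by rewrite E !coefD !coefMX /= addr0 P1 QHQ addrC.
Qed.

Lemma avg_poly T (F : R -> seq bool -> R) (a b : seq bool -> R) :
  (forall xs, exists p : {poly R}, [/\ forall h, p.[h] = F h xs, p`_0 = a xs & p`_1 = b xs]) ->
  exists p : {poly R},
    [/\ forall h, p.[h] = avg T (F h), p`_0 = avg T a & p`_1 = avg T b].
Proof.
elim: T F a b => [|T IH] F a b hF /=; first exact: hF.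
have [p [ph p0 p1]] := IH (fun h xs => F h (true :: xs)) _ _ (fun xs => hF (true :: xs)).
have [q [qh q0 q1]] := IH (fun h xs => F h (false :: xs)) _ _ (fun xs => hF (false :: xs)).
exists ((p + q) * (2^-1)%:P); split.
- by move=> h; rewrite hornerM hornerD hornerC ph qh.
- by rewrite coefMC coefD p0 q0.
- by rewrite coefMC coefD p1 q1.
Qed.

(** With [N = 2 ^ k] and [h = 1 / N], the power [N] of the average normalised squared norm is at
    most the average trace of the power [N] of the Gram matrix, hence at most [m]; [coef1_le_ln]
    passes to the derivative at 0. *)
Lemma avg_gain_le l : (0 < m)%N ->
  avg (size l) (gain l) <= 4 * sqnorm e * ln m%:R.
Proof.
move=> m0.
have [|p [ph p0 p1]] := @avg_poly (size l)
  (fun h xs => sqnorm (wprod h l xs *m e) / sqnorm e) (fun=> 1)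
  (fun xs => (sqnorm e)^-1 * gain l xs).
  move=> xs; have [P [Ph _ P0 P1]] := wprod_poly l xs.
  exists ((P^T *m P) 0 0 * ((sqnorm e)^-1)%:P); split.
  - move=> h; rewrite hornerM hornerC -Ph /sqnorm map_trmx -map_mxM [in RHS]mxE.
    by rewrite /horner_eval.
  - by rewrite coefMC P0 divff // gt_eqF.
  - by rewrite coefMC P1 mulrC.
have m1 : 1 <= m%:R :> R by rewrite ler1n.
have := @coef1_le_ln R p m%:R m1.
rewrite p0 avg_cst p1 avgZ => /(_ erefl) hk.
rewrite -mulrA mulrCA -ler_pdivrMl //; apply: hk => k k0.
rewrite ph; apply: le_trans (avg_pow2_le _ _ _) _.
have := @wprod_avg_le k _ l 1 k0 erefl (trmx1 _ _).
rewrite expr1n mxtrace1; apply: le_trans; apply: avg_le => xs _.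
set W := wprod _ _ _.
have -> : sqnorm (W *m e) = quad (W^T * 1 * W) e.
  by rewrite mulr1 /quad /sqnorm trmx_mul !mulmxA.
rewrite expr_div_n ler_pdivrMr ?exprn_gt0 // mulrC.
by apply: quad_pow2_trace_le => //; rewrite mulr1 trmxM trmxK.
Qed.

End RandomProduct.

(** * Phases and rotations *)

Section TrigoBounds.
Variable R : realType.
Implicit Types x y : R.

Lemma sin_MVT x : 0 < x -> exists2 c, 0 < c < x & sin x = cos c * x.
Proof.
move=> x0.
have [|c] := @MVT R sin cos 0 x x0 (fun y _ => is_derive_sin y).
- exact/continuous_subspaceT/continuous_sin.
by rewrite in_itv /= sin0 !subr0 => cx E; exists c.
Qed.

Lemma sin_sqr_le x : sin x ^+ 2 <= x ^+ 2.
Proof.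
wlog x0 : x / 0 <= x.
  move=> h; have [/h //|x0] := leP 0 x.
  by rewrite -sqrrN -sinN -[leRHS]sqrrN; apply: h; lra.
move: x0; rewrite le0r => /orP[/eqP ->|x0]; first by rewrite sin0.
have [c _ ->] := sin_MVT x0.
rewrite exprMn ler_piMl ?sqr_ge0 // cos2sin2.
by have := sqr_ge0 (sin c); lra.
Qed.

Lemma cos_ge x : 1 - x ^+ 2 / 2 <= cos x.
Proof.
have -> : x = (x / 2) *+ 2 by rewrite -mulr_natr; field.
rewrite cos_mulr2n cos2sin2.
by have := sin_sqr_le (x / 2); lra.
Qed.

Lemma sin_ge_half x : 0 <= x <= 1 -> x / 2 <= sin x.
Proof.
move=> /andP[]; rewrite le0r => /orP[/eqP -> _|x0 x1]; first by rewrite sin0 mul0r.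
have [c /andP[c0 cx] ->] := sin_MVT x0.
rewrite mulrC ler_pM2r //; apply: le_trans (cos_ge c); nra.
Qed.

Lemma prod_cos_ge (I : Type) (r : seq I) (b : I -> R) :
  \sum_(j <- r) b j ^+ 2 <= 2 ->
  1 - (\sum_(j <- r) b j ^+ 2) / 2 <= \prod_(j <- r) cos (b j) <= 1.
Proof.
elim: r => [|j r IH]; first by rewrite !big_nil; lra.
rewrite !big_cons; have := cos_ge (b j); have := cos_le1 (b j).
have S0 : 0 <= \sum_(j <- r) b j ^+ 2 by rewrite sumr_ge0 // => k _; rewrite sqr_ge0.
have b0 := sqr_ge0 (b j).
move=> c1 c2 h.
have /IH/andP[] : \sum_(j <- r) b j ^+ 2 <= 2 by lra.
set S := \sum_(j <- r) _ in S0 h *; set P := \prod_(j <- r) _ => P1 P2.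
apply/andP; split; last by nra.
apply: le_trans (_ : (1 - b j ^+ 2 / 2) * (1 - S / 2) <= _); first by nra.
by apply: ler_pM => //; lra.
Qed.

End TrigoBounds.

Section Rotation.
Variables (R : realType) (n : nat).
Implicit Types (psi : 'I_n -> R).

(** The real form of the diagonal unitary with entries [exp (i psi_a)]: real parts come first,
    imaginary parts second. In the same coordinates [circ psi] is the vector of these phases. *)
Definition rotmx psi : 'M[R]_(n + n) :=
  block_mx (diag_mx (\row_a cos (psi a))) (- diag_mx (\row_a sin (psi a)))
           (diag_mx (\row_a sin (psi a))) (diag_mx (\row_a cos (psi a))).

Definition circ psi : 'cV[R]_(n + n) :=
  col_mx (\col_a cos (psi a)) (\col_a sin (psi a)).

Lemma rotmx_orth psi : (rotmx psi)^T * rotmx psi = 1.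
Proof.
rewrite -mulmxE /rotmx tr_block_mx !linearN /= !tr_diag_mx mulmx_block.
rewrite !mulNmx !mulmxN !mulmx_diag opprK.
rewrite -[1 in RHS]/(1%:M) (scalar_mx_block n n); congr block_mx;
  apply/matrixP => i j; rewrite !mxE; case: eqP => _ /=; rewrite ?mulr0n ?mulr1n.
- by rewrite -!expr2 cos2Dsin2.
- by rewrite addr0.
- by ring.
- by rewrite oppr0 addr0.
- by ring.
- by rewrite oppr0 addr0.
- by rewrite -!expr2 addrC cos2Dsin2.
- by rewrite addr0.
Qed.

Lemma rotmx_circ phi psi : rotmx phi *m circ psi = circ (fun a => phi a + psi a).
Proof.
rewrite /rotmx /circ mul_block_col mulNmx !mul_diag_mx.
by congr col_mx; apply/matrixP => a b; rewrite !mxE ?cosD ?sinD // addrC.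
Qed.

Lemma sqnorm_col (f g : 'cV[R]_n) : sqnorm (col_mx f g) = sqnorm f + sqnorm g.
Proof. by rewrite /sqnorm tr_col_mx mul_row_col mxE. Qed.

Lemma sqnorm_circ psi : sqnorm (circ psi) = n%:R.
Proof.
rewrite sqnorm_col !sqnormE -big_split /=.
under eq_bigr do rewrite !mxE cos2Dsin2.
by rewrite sumr_const card_ord.
Qed.

Variables (pr : 'I_n -> 'I_n) (sg : 'I_n -> R).
Hypothesis prK : involutive pr.
Hypothesis sgN : forall a, sg (pr a) = - sg a.
Hypothesis sg3 : forall a, sg a ^+ 3 = sg a.

Definition pairing_mx : 'M[R]_n := \matrix_(a, b) (sg a * (b == pr a)%:R).

(** The real form of [i] times [pairing_mx]; it is symmetric because [pairing_mx] is antisymmetric.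
    The hypotheses on [sg] force values in -1, 0, 1, opposite on partners and 0 at fixed points of
    [pr]. *)
Definition gen_mx : 'M[R]_(n + n) := block_mx 0 (- pairing_mx) pairing_mx 0.

Lemma pairing_mxM (p : nat) (B : 'M[R]_(n, p)) :
  pairing_mx *m B = \matrix_(a, b) (sg a * B (pr a) b).
Proof.
apply/matrixP => a b; rewrite !mxE (bigD1 (pr a)) //= mxE eqxx mulr1 big1 ?addr0 //.
by move=> c /negbTE ca; rewrite mxE ca mulr0 mul0r.
Qed.

Lemma pairing_mx3 : pairing_mx *m pairing_mx *m pairing_mx = - pairing_mx.
Proof.
rewrite -mulmxA !pairing_mxM; apply/matrixP => a b; rewrite !mxE prK sgN.
by rewrite -[in RHS](sg3 a); ring.
Qed.

Lemma pairing_mx_tr : pairing_mx^T = - pairing_mx.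
Proof.
apply/matrixP => a b; rewrite !mxE; case: (eqVneq b (pr a)) => [->|ba].
  by rewrite prK !eqxx sgN !mulr1.
case: eqP => [ab|_]; first by rewrite ab prK eqxx in ba.
by rewrite !mulr0 oppr0.
Qed.

Lemma gen_mx_tr : gen_mx^T = gen_mx.
Proof. by rewrite /gen_mx tr_block_mx !trmx0 linearN /= pairing_mx_tr opprK. Qed.

Lemma gen_mx3 : gen_mx * gen_mx * gen_mx = gen_mx.
Proof.
rewrite -!mulmxE /gen_mx !mulmx_block !(mul0mx, mulmx0, add0r, addr0, mulNmx, mulmxN, oppr0).
by rewrite pairing_mx3 ?opprK.
Qed.

Lemma gen_mx_circ psi : gen_mx *m circ psi =
  col_mx (\col_a (- (sg a * sin (psi (pr a))))) (\col_a (sg a * cos (psi (pr a)))).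
Proof.
rewrite /gen_mx mul_block_col !mul0mx add0r addr0 mulNmx !pairing_mxM.
by congr col_mx; apply/matrixP => a b; rewrite !mxE.
Qed.

Lemma quad_gen psi :
  quad gen_mx (circ psi) = \sum_a sg a * sin (psi a - psi (pr a)).
Proof.
rewrite /quad -mulmxA gen_mx_circ tr_col_mx mul_row_col !mxE -big_split /=.
by apply: eq_bigr => a _; rewrite !mxE sinB; ring.
Qed.

Lemma quad_gen2 psi : quad (gen_mx * gen_mx) (circ psi) = \sum_a sg a ^+ 2.
Proof.
rewrite quad_sym_sqr ?gen_mx_tr // gen_mx_circ sqnorm_col !sqnormE -big_split /=.
apply: eq_bigr => a _; rewrite !mxE sqrrN !exprMn -mulrDr addrC cos2Dsin2 mulr1 //.
Qed.

Lemma quad_drift lam x psi : quad (drift lam x gen_mx) (circ psi) =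
  lam * (bsign R x * \sum_a sg a * sin (psi a - psi (pr a)))
  - 4 * lam ^+ 2 * \sum_a sg a ^+ 2.
Proof.
rewrite -quad_gen -(quad_gen2 psi) /quad /drift mulmxBr mulmxBl.
by rewrite -!scalemxAr -!scalemxAl !mxE; ring.
Qed.

End Rotation.

(** * The serial random access code and its dimension bound *)

Section Decoding.
Variables (R : realType) (n : nat) (I : Type).
Variables (pr : I -> 'I_n -> 'I_n) (sg : I -> 'I_n -> R) (phi : I -> 'I_n -> R).
Hypothesis prK : forall i, involutive (pr i).
Hypothesis sgN : forall i a, sg i (pr i a) = - sg i a.
Hypothesis sg3 : forall i a, sg i a ^+ 3 = sg i a.

Let A i := gen_mx (pr i) (sg i).
Let O i (x : bool) := rotmx (fun a => bsign R x * phi i a).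
Let e : 'cV[R]_(n + n) := circ (fun=> 0).

Fixpoint phase (l : seq I) (xs : seq bool) (a : 'I_n) : R :=
  match l, xs with
  | i :: l', x :: xs' => bsign R x * phi i a + phase l' xs' a
  | _, _ => 0
  end.

Lemma zvec_phase l xs : zvec O e l xs = circ (phase l xs).
Proof.
elim: l xs => [|i l IH] [|x xs] //=.
by rewrite IH rotmx_circ.
Qed.

Lemma avg_cos_phase l a b :
  avg (size l) (fun xs => cos (phase l xs a - phase l xs b)) =
  \prod_(j <- l) cos (phi j a - phi j b).
Proof.
elim: l => [|i l IH] /=; first by rewrite big_nil subrr cos0.
rewrite big_cons -IH -avgD -avgZ mulrC -avgZ; apply: eq_avg => xs _.
set y := phase l xs a; set z := phase l xs b.
have -> : 1 * phi i a + y - (1 * phi i b + z) = (phi i a - phi i b) + (y - z) by ring.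
have -> : -1 * phi i a + y - (-1 * phi i b + z) = - (phi i a - phi i b) + (y - z) by ring.
by move: (phi i a - phi i b) (y - z) => u w; rewrite !cosD cosN sinN; field.
Qed.

(** Averaging [x * sin (x * u + w)] over the sign [x] leaves [sin u * cos w]. Here [w] is the phase
    difference due to the later signs, and averaging its cosine gives the product of cosines. *)
Lemma avg_gain_cons lam i l :
  avg (size (i :: l)) (gain A O lam e (i :: l)) =
  \sum_a (lam * (sg i a * sin (phi i a - phi i (pr i a)) *
            \prod_(j <- l) cos (phi j a - phi j (pr i a)))
          - 4 * lam ^+ 2 * sg i a ^+ 2)
  + avg (size l) (gain A O lam e l).
Proof.
pose Q x := avg (size l) (fun xs => quad (drift lam x (A i)) (O i x *m zvec O e l xs)).
have -> : avg (size (i :: l)) (gain A O lam e (i :: l)) =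
    (Q true + Q false) / 2 + avg (size l) (gain A O lam e l).
  by rewrite /= !avgD /Q; field.
congr (_ + _); symmetry.
have half xs : 2^-1 * (quad (drift lam true (A i)) (O i true *m zvec O e l xs) +
    quad (drift lam false (A i)) (O i false *m zvec O e l xs)) =
  \sum_a (lam * (sg i a * sin (phi i a - phi i (pr i a))) *
     cos (phase l xs a - phase l xs (pr i a)) - 4 * lam ^+ 2 * sg i a ^+ 2).
  rewrite zvec_phase !rotmx_circ !quad_drift // sumrB -mulr_sumr.
  set S1 := (X in bsign R true * X); set S2 := (X in bsign R false * X).
  suff -> : \sum_a (lam * (sg i a * sin (phi i a - phi i (pr i a))) *
     cos (phase l xs a - phase l xs (pr i a))) = lam * ((S1 - S2) / 2).
    by rewrite /bsign; field.
  rewrite /S1 /S2 -sumrB mulr_suml mulr_sumr; apply: eq_bigr => a _.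
  set y := phase l xs a; set z := phase l xs _.
  have -> : bsign R true * phi i a + y - (bsign R true * phi i (pr i a) + z) =
    (phi i a - phi i (pr i a)) + (y - z) by rewrite /bsign; ring.
  have -> : bsign R false * phi i a + y - (bsign R false * phi i (pr i a) + z) =
    - (phi i a - phi i (pr i a)) + (y - z) by rewrite /bsign; ring.
  by move: (phi i a - phi i _) (y - z) => u w; rewrite !sinD cosN sinN; field.
rewrite /Q -avgD [RHS]mulrC -avgZ (eq_avg (fun xs _ => half xs)).
rewrite avg_sum; apply: eq_bigr => a _.
have -> : avg (size l) (fun xs => lam * (sg i a * sin (phi i a - phi i (pr i a))) *
     cos (phase l xs a - phase l xs (pr i a)) - 4 * lam ^+ 2 * sg i a ^+ 2) =
  lam * (sg i a * sin (phi i a - phi i (pr i a))) *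
     avg (size l) (fun xs => cos (phase l xs a - phase l xs (pr i a)))
   - 4 * lam ^+ 2 * sg i a ^+ 2.
  by rewrite avgD avg_cst avgZ.
by rewrite avg_cos_phase; ring.
Qed.

(* Once the signs of the steps preceding [i] are known, what is left of the phase
   difference of a pair matched by [i] is correlated with the sign of step [i]. *)
Fixpoint decodable (eps : R) (l : seq I) : Prop :=
  if l is i :: l' then
    (forall a, sg i a != 0 ->
       eps <= sg i a * sin (phi i a - phi i (pr i a)) *
              \prod_(j <- l') cos (phi j a - phi j (pr i a)))
    /\ decodable eps l'
  else True.

Lemma sum_sg_sqr_le eps l : (0 < n)%N -> 0 <= eps <= 1 -> decodable eps l ->
  eps ^+ 2 * \sum_(i <- l) \sum_a sg i a ^+ 2 <= 64 * n%:R * ln (n + n)%:R.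
Proof.
move=> n0 /andP[e0 e1] hl.
(* This maximises [lam * eps - 4 * lam ^+ 2], the guaranteed gain per matched vertex, which becomes
   [lam * eps / 2]. *)
pose lam := eps / 8.
have h : lam * eps / 2 * \sum_(i <- l) \sum_a sg i a ^+ 2 <=
    avg (size l) (gain A O lam e l).
  elim: l hl => [|i l IH]; first by rewrite big_nil mulr0.
  move=> [hi /IH{}IH]; rewrite big_cons mulrDr avg_gain_cons.
  apply: lerD => //; rewrite mulr_sumr; apply: ler_sum => a _.
  have [->|s0] := eqVneq (sg i a) 0; first by rewrite expr0n !mul0r !mulr0 subr0.
  have s2 : sg i a ^+ 2 = 1.
    by apply: (mulfI s0); rewrite -exprS sg3 mulr1.
  have := hi a s0; set C := _ * \prod_(j <- l) _ => hC.
  have l0 : 0 <= lam by rewrite /lam divr_ge0.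
  have : lam * eps <= lam * C by rewrite ler_wpM2l.
  have -> : 4 * lam ^+ 2 = lam * eps / 2 by rewrite /lam; field.
  rewrite s2; lra.
have := @avg_gain_le R (n + n) I A O lam e _ _ _ _ _ l.
rewrite sqnorm_circ => hg.
have {hg} := le_trans h (hg _ _ _ _ _ _).
have -> : lam * eps / 2 = eps ^+ 2 / 16 by rewrite /lam; field.
move=> hh; suff : eps ^+ 2 / 16 * \sum_(i <- l) \sum_a sg i a ^+ 2 <= 4 * n%:R * ln (n + n)%:R by lra.
apply: hh.
- by move=> i; apply: gen_mx_tr.
- by move=> i; apply: gen_mx3.
- by move=> i x; apply: rotmx_orth.
- by rewrite /lam; lra.
- by rewrite ltr0n.
- by rewrite addn_gt0 n0.
Qed.

End Decoding.

(** * Dyadic scales *)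

Lemma sum_uniq_le (R : realFieldType) (T : finType) (l : seq T) (P : pred T) (F : T -> R) :
  uniq l -> all P l -> (forall j, 0 <= F j) ->
  \sum_(j <- l) F j <= \sum_(j | P j) F j.
Proof.
move=> ul /allP lP F0; rewrite (big_uniq _ ul) /= big_mkcond [leRHS]big_mkcond /=.
apply: ler_sum => j _; case: ifP => [/lP ->//|_]; by case: ifP.
Qed.

Lemma sum_geometric_le (R : realFieldType) (s S : nat) :
  \sum_(t < S | (s <= t)%N) ((4 : R) ^+ t)^-1 <= 4 / 3 * (4 ^+ s)^-1.
Proof.
have p4 t : 0 < ((4 : R) ^+ t)^-1 by rewrite invr_gt0 exprn_gt0.
suff : \sum_(t < S | (s <= t)%N) ((4 : R) ^+ t)^-1 <=
    if (s <= S)%N then 4 / 3 * ((4 ^+ s)^-1 - (4 ^+ S)^-1) else 0.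
  by case: ifP => _ h; apply: le_trans h _; have := p4 s; have := p4 S; lra.
elim: S => [|S IH].
  by rewrite big_ord0; case: s => [|s] //=; rewrite subrr mulr0.
rewrite big_mkcond big_ord_recr -big_mkcond /=.
have S4 : ((4 : R) ^+ S.+1)^-1 = (4 ^+ S)^-1 / 4 by rewrite exprS invfM mulrC.
case: (ltngtP s S.+1) => sS.
- by rewrite ltnS in sS; rewrite sS in IH *; rewrite S4; lra.
- by rewrite leqNgt (ltn_trans _ sS) // in IH *; rewrite /= addr0.
- by rewrite sS ltnn in IH *; rewrite subrr mulr0 addr0.
Qed.

Section Scales.
Variables (R : realType) (n d : nat) (w : 'I_n -> 'I_d -> R).
Variables (pr : 'I_d -> 'I_n -> 'I_n) (g : 'I_d -> pred 'I_n).
Hypothesis prK : forall i, involutive (pr i).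
Hypothesis g_pr : forall i a, g i (pr i a) = g i a.

Let y i a k := w a k - w (pr i a) k.
Let q i a := \sum_k y i a k ^+ 2.

Hypothesis q_gt0 : forall i a, g i a -> 0 < q i a.
Hypothesis q_le : forall i a, g i a -> q i a <= 25 * y i a i ^+ 2.

Let y_pr i a k : y i (pr i a) k = - y i a k.
Proof. by rewrite /y prK opprB. Qed.

Let q_pr i a : q i (pr i a) = q i a.
Proof. by apply: eq_bigr => k _; rewrite y_pr sqrrN. Qed.

Let scale_exists : exists2 r : R, 0 < r &
  exists S : nat, forall i a, g i a ->
    exists2 s : 'I_S, r ^+ 2 * 4 ^+ s <= q i a & q i a < r ^+ 2 * 4 ^+ s.+1.
Proof.
have [|r r0 hr] := @near0_all R _ (enum {: 'I_d * 'I_n})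
   (fun ia t => g ia.1 ia.2 -> t ^+ 2 <= q ia.1 ia.2).
  move=> [i a] _ /=; case gia : (g i a); last by exists 1.
  have q0 := q_gt0 gia.
  exists (Num.min 1 (q i a)); first by rewrite lt_min ltr01.
  move=> t; rewrite le_min => /and3P[t0 t1 tq] _; apply: le_trans tq.
  by rewrite expr2 ler_piMl // ltW.
exists r => //.
have {}hr i a : g i a -> r ^+ 2 <= q i a.
  by apply: (hr r _ (i, a)); rewrite ?mem_enum // r0 lexx.
have r2 : 0 < r ^+ 2 by rewrite exprn_gt0.
(* A crude bound: [4 ^ S] exceeds every ratio [q / r ^+ 2], so finitely many scales cover all good
   pairs. *)
pose S := (\sum_ia (Num.Def.truncn (q ia.1 ia.2 / r ^+ 2)).+1)%N.
exists S => i a gia.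
have qS : q i a < r ^+ 2 * 4 ^+ S.
  rewrite mulrC -ltr_pdivrMr //; apply: lt_le_trans (truncnS_gt _) _.
  apply: le_trans (_ : S%:R <= _).
    by rewrite ler_nat /S (bigD1 (i, a)) //= leq_addr.
  by rewrite -natrX ler_nat ltnW // ltn_expl.
have ex : exists t, q i a < r ^+ 2 * 4 ^+ t by exists S.
case: (ex_minnP ex) => -[|s] hs smin.
  by move: hs; rewrite expr0 mulr1 ltNge hr.
have sS : (s < S)%N by apply: smin.
exists (Ordinal sS) => //=; rewrite leNgt; apply/negP => /smin.
by rewrite ltnn.
Qed.

(** One code step is taken for each scale and coordinate. Every good pair lies in a scale, and
    [decodable] holds with constant 1/60. *)
Lemma sum_good_le : (0 < n)%N ->
  (\sum_i \sum_a g i a)%:R <= 64 * 60 ^+ 2 * n%:R * ln (n + n)%:R :> R.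
Proof.
move=> n0; have [r r0 [S hS]] := scale_exists.
have r2 : 0 < r ^+ 2 by rewrite exprn_gt0.
pose J := ('I_S * 'I_d)%type.
pose gs (j : J) a := [&& g j.2 a, r ^+ 2 * 4 ^+ j.1 <= q j.2 a & q j.2 a < r ^+ 2 * 4 ^+ j.1.+1].
pose prs (j : J) a := if gs j a then pr j.2 a else a.
(* The sign of the coordinate difference makes the decoded correlation nonnegative; it vanishes off
   [gs], where [prs] fixes the vertex. *)
pose sgs (j : J) a : R := Num.sg (w a j.2 - w (prs j a) j.2).
pose phi (j : J) a : R := w a j.2 / (2 * r * 2 ^+ j.1).
have gs_pr j a : gs j (pr j.2 a) = gs j a by rewrite /gs g_pr q_pr.
have prsK j : involutive (prs j).
  by move=> a; rewrite /prs; case h: (gs j a); rewrite ?gs_pr h ?prK.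
have sgsN j a : sgs j (prs j a) = - sgs j a by rewrite /sgs prsK -sgrN opprB.
have sgs3 j a : sgs j a ^+ 3 = sgs j a.
  by rewrite /sgs; case: sgrP => _; rewrite ?expr0n ?expr1n // -signr_odd /= expr1.
pose leJ (j k : J) := (j.1 <= k.1)%N.
(* Finer scales come first, so only steps of equal or coarser scale follow a given step and enter
   its product of cosines. *)
pose l := sort leJ (enum {: J}).
have leJ_tr : transitive leJ by move=> ? ? ?; apply: leq_trans.
have sorted_l : sorted leJ l by apply: sort_sorted => j k; apply: leq_total.
have uniq_l : uniq l by rewrite sort_uniq enum_uniq.
have dec : decodable prs sgs phi (1 / 60) l.
  elim: l sorted_l uniq_l => [|[s i] l IH] //= pl /andP[_ ul].
  split; last by apply: IH => //; apply: path_sorted pl.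
  move=> a s0.
  have gsa : gs (s, i) a.
    by apply: contraR s0 => /negbTE h; rewrite /sgs /prs h subrr sgr0.
  have pa : prs (s, i) a = pr i a by rewrite /prs gsa.
  rewrite pa.
  case/and3P: (gsa) => /= ga q1 q2.
  have d2 t : 0 < 2 * r * 2 ^+ t :> R by rewrite !mulr_gt0 // exprn_gt0.
  have phiE j : phi j a - phi j (pr i a) = y i a j.2 / (2 * r * 2 ^+ j.1).
    by rewrite /phi -mulrBl.
  have d22 t : (2 * r * 2 ^+ t) ^+ 2 = 4 * (r ^+ 2 * 4 ^+ t).
    by rewrite !exprMn -exprM mulnC exprM [2 ^+ 2](_ : _ = 4 :> R) ?mulrA //; ring.
  have p4 t : 0 < r ^+ 2 * 4 ^+ t by rewrite mulr_gt0 // exprn_gt0.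
  under eq_bigr do rewrite phiE.
  rewrite phiE /=.
  have sE : sgs (s, i) a = Num.sg (y i a i) by rewrite /sgs pa.
  rewrite sE -sin_sg mulrA -normrEsg.
  set b := `|y i a i| / _.
  have b0 : 0 <= b by rewrite divr_ge0 // ltW.
  have b2 : b ^+ 2 = y i a i ^+ 2 / (4 * (r ^+ 2 * 4 ^+ s)).
    by rewrite expr_div_n d22 real_normK // num_real.
  have q2' : q i a < 4 * (r ^+ 2 * 4 ^+ s) by rewrite mulrCA -exprS.
  have Z0 := p4 s; set Z := r ^+ 2 * 4 ^+ s in q1 q2' b2 Z0.
  have Z4 : 0 < 4 * Z by lra.
  have yq : y i a i ^+ 2 <= q i a.
    by rewrite /q (bigD1 i) //= lerDl sumr_ge0 // => k _; rewrite sqr_ge0.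
  have b1 : b <= 1.
    rewrite -(@ler_pXn2r _ 2) ?nnegrE // expr1n b2 ler_pdivrMr //; lra.
  have n10 : 0 <= 1 / 10 :> R by lra.
  (* The length of the pair is at least [r * 2 ^+ s], coordinate [i] carries at least a fifth of it,
     and [phi] divides by [2 * r * 2 ^+ s]. *)
  have b10 : 1 / 10 <= b.
    rewrite -(@ler_pXn2r _ 2) ?nnegrE // b2 ler_pdivlMr //.
    by have := q_le ga; lra.
  have sb : b / 2 <= sin b by apply: sin_ge_half; rewrite b0.
  (* At scale [t >= s] the squared phase differences sum over the coordinates to
     [q i a / (4 * r ^+ 2 * 4 ^+ t)], at most [4 ^+ s / 4 ^+ t]: a geometric series. *)
  have later : \sum_(j <- l) (y i a j.2 / (2 * r * 2 ^+ j.1)) ^+ 2 <= 4 / 3.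
    apply: le_trans (sum_uniq_le ul (order_path_min leJ_tr pl) _) _.
      by move=> j; rewrite sqr_ge0.
    rewrite (eq_bigl (fun p : J => (s <= p.1)%N && true)) => [|p]; last by rewrite andbT.
    rewrite -(pair_big (fun t : 'I_S => (s <= t)%N) xpredT
       (fun (t : 'I_S) k => (y i a k / (2 * r * 2 ^+ t)) ^+ 2)) /=.
    apply: le_trans (_ : \sum_(t < S | (s <= t)%N) 4 ^+ s * (4 ^+ t)^-1 <= _).
      apply: ler_sum => t _.
      under eq_bigr do rewrite expr_div_n d22.
      rewrite -mulr_suml -/(q i a) ler_pdivrMr ?mulr_gt0 ?exprn_gt0 //.
      have -> : 4 ^+ s / 4 ^+ t * (4 * (r ^+ 2 * 4 ^+ t)) = r ^+ 2 * 4 ^+ s.+1.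
        have : 4 ^+ t != 0 :> R by rewrite gt_eqF // exprn_gt0.
        by rewrite [4 ^+ s.+1]exprS; move: (4 ^+ s) (4 ^+ t) => u v v0; field.
      exact: ltW.
    rewrite -mulr_sumr.
    apply: le_trans (ler_wpM2l _ (sum_geometric_le _ _ _)) _; first by rewrite exprn_ge0.
    by rewrite mulrCA divff ?mulr1 // gt_eqF // exprn_gt0.
  have pc : 1 / 3 <= \prod_(j <- l) cos (y i a j.2 / (2 * r * 2 ^+ j.1)).
    have /prod_cos_ge/andP[h _] : \sum_(j <- l) (y i a j.2 / (2 * r * 2 ^+ j.1)) ^+ 2 <= 2.
      by apply: le_trans later _; lra.
    by apply: le_trans h; lra.
  (* The sine contributes [b / 2 >= 1 / 20] and the cosines contribute [1 - (4 / 3) / 2 = 1 / 3]. *)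
  have -> : 1 / 60 = 1 / 20 * (1 / 3) :> R by field.
  by apply: ler_pM => //; lra.
have e01 : 0 <= (1 / 60 : R) <= 1 by lra.
have := sum_sg_sqr_le prsK sgsN sgs3 n0 e01 dec.
suff : (\sum_i \sum_a g i a)%:R <= \sum_(j <- l) \sum_a sgs j a ^+ 2.
  set u := (\sum_i _)%:R; set v := \sum_(j <- l) _; set t := ln _; nra.
have -> : \sum_(j <- l) \sum_a sgs j a ^+ 2 = \sum_i \sum_a \sum_s sgs (s, i) a ^+ 2.
  rewrite (perm_big (enum {: J})) /=; last by rewrite perm_sort.
  rewrite big_enum /= -(pair_big xpredT xpredT (fun s i => \sum_a sgs (s, i) a ^+ 2)) /=.
  by rewrite exchange_big /=; apply: eq_bigr => i _; rewrite exchange_big.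
rewrite natr_sum; apply: ler_sum => i _; rewrite natr_sum; apply: ler_sum => a _.
case gia : (g i a); last by rewrite sumr_ge0 // => s _; rewrite sqr_ge0.
have [s s1 s2] := hS i a gia.
rewrite (bigD1 s) //= /sgs /prs /gs /= gia s1 s2 /= -/(y i a i) sqr_sg.
have -> : y i a i != 0.
  apply/eqP => y0; have := q_le gia; have := q_gt0 gia; rewrite y0 expr0n /=; lra.
by rewrite lerDl sumr_ge0 // => t _; rewrite sqr_ge0.
Qed.

End Scales.

(** * Planes and the random normalisation *)

Section DotProduct.
Variables (R : realType) (d : nat).
Implicit Types u v z : 'rV[R]_d.

Lemma dotpC u v : dotp u v = dotp v u.
Proof. by apply: eq_bigr => k _; rewrite mulrC. Qed.

Lemma dotpDl u v z : dotp (u + v) z = dotp u z + dotp v z.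
Proof. by rewrite /dotp -big_split; apply: eq_bigr => k _; rewrite mxE mulrDl. Qed.

Lemma dotpZl c u z : dotp (c *: u) z = c * dotp u z.
Proof. by rewrite /dotp mulr_sumr; apply: eq_bigr => k _; rewrite mxE mulrA. Qed.

Lemma dotpDr u v z : dotp z (u + v) = dotp z u + dotp z v.
Proof. by rewrite !(dotpC z) dotpDl. Qed.

Lemma dotpZr c u z : dotp z (c *: u) = c * dotp z u.
Proof. by rewrite !(dotpC z) dotpZl. Qed.

Lemma dotp0l u : dotp 0 u = 0.
Proof. by rewrite /dotp big1 // => k _; rewrite mxE mul0r. Qed.

Lemma dotp_ge0 u : 0 <= dotp u u.
Proof. by rewrite sumr_ge0 // => k _; rewrite -expr2 sqr_ge0. Qed.

Lemma dotp_gt0 u : u != 0 -> 0 < dotp u u.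
Proof.
move=> u0; rewrite lt_def dotp_ge0 andbT; apply: contra_neq u0 => /eqP.
rewrite psumr_eq0 => [/allP h|k _]; last by rewrite -expr2 sqr_ge0.
apply/rowP => k; have := h k (mem_index_enum _).
by rewrite -expr2 sqrf_eq0 mxE => /eqP.
Qed.

Lemma dotp_delta u i : dotp u (delta_mx 0 i) = u 0 i.
Proof.
rewrite /dotp (bigD1 i) //= big1 ?addr0 => [|k ki]; rewrite mxE !eqxx /= ?mulr1 //.
by rewrite (negbTE ki) mulr0.
Qed.

(** Bessel's inequality: the residual of the basis vector [i] after projection to the plane of [u]
    and [z] has nonnegative squared length. *)
Lemma bessel2 u z i : dotp u u = 1 -> dotp z z = 1 -> dotp u z = 0 ->
  u 0 i ^+ 2 + z 0 i ^+ 2 <= 1.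
Proof.
move=> uu zz uz.
have := dotp_ge0 (delta_mx 0 i + (- u 0 i) *: u + (- z 0 i) *: z).
rewrite !(dotpDl, dotpDr, dotpZl, dotpZr) uu zz uz (dotpC z u) uz.
by rewrite !(dotpC (delta_mx 0 i) u) !(dotpC (delta_mx 0 i) z) !dotp_delta mxE !eqxx /=; lra.
Qed.

Definition plane_basis u z (va vb : 'rV[R]_d) : Prop :=
  [/\ dotp u u = 1, dotp z z = 1, dotp u z = 0 &
    exists p q p' q',
      [/\ va = p *: u + q *: z, vb = p' *: u + q' *: z & p * q' - q * p' != 0]].

Lemma plane_basis_neq0 u z va vb : plane_basis u z va vb -> va != 0 /\ vb != 0.
Proof.
move=> [uu zz uz [p [q [p' [q' [vaE vbE D0]]]]]].
have coord0 r s : r *: u + s *: z = 0 -> r = 0 /\ s = 0.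
  move=> E; have ru : dotp (r *: u + s *: z) u = r.
    by rewrite dotpDl !dotpZl uu (dotpC z) uz; ring.
  have sz : dotp (r *: u + s *: z) z = s by rewrite dotpDl !dotpZl zz uz; ring.
  by split; [rewrite -ru | rewrite -sz]; rewrite E dotp0l.
by split; apply: contra_neq D0 => v0; rewrite v0 in vaE vbE;
  [case: (coord0 _ _ (esym vaE)) | case: (coord0 _ _ (esym vbE))] => -> ->; ring.
Qed.

(** The components of [va] and [vb] orthogonal to [u] satisfy a nontrivial linear relation, hence
    are parallel. If one is nonzero, normalising it gives [z]; otherwise both vectors are multiples
    of [u]. *)
Lemma plane_basis_or_parallel u (va vb : 'rV[R]_d) x y :
  u = x *: va + y *: vb -> dotp u u = 1 ->
  (exists z, plane_basis u z va vb) \/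
  exists ca cb, [/\ va = ca *: u, vb = cb *: u & x * ca + y * cb = 1].
Proof.
move=> uE uu.
pose res v := v - dotp v u *: u.
have res_u v : dotp u (res v) = 0.
  by rewrite /res -scaleNr dotpDr dotpZr uu (dotpC u v); ring.
have vE v : v = dotp v u *: u + res v by rewrite /res addrC subrK.
have xy : x * dotp va u + y * dotp vb u = 1 by rewrite -!dotpZl -dotpDl -uE.
have rxy : x *: res va + y *: res vb = 0.
  rewrite /res !scalerBr addrACA -uE !scalerA -opprD -scalerDl xy scale1r subrr //.
have main z qa qb : dotp z z = 1 -> dotp u z = 0 -> res va = qa *: z -> res vb = qb *: z ->
    (qa != 0) || (qb != 0) -> plane_basis u z va vb.
  move=> zz uz ra rb qq; split => //.
  exists (dotp va u), qa, (dotp vb u), qb; split; rewrite -?ra -?rb -?vE //.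
  have E : x * qa + y * qb = 0.
    by have := congr1 (fun r => dotp r z) rxy; rewrite /= ra rb dotpDl !dotpZl zz dotp0l; lra.
  apply/eqP => D0; case/orP: qq => /eqP; apply.
    have : qa * (x * dotp va u + y * dotp vb u) = 0.
      have -> : qa * (x * dotp va u + y * dotp vb u) = dotp va u * (x * qa + y * qb)
        - y * (dotp va u * qb - qa * dotp vb u) by ring.
      by rewrite E D0; ring.
    by rewrite xy mulr1.
  have : qb * (x * dotp va u + y * dotp vb u) = 0.
    have -> : qb * (x * dotp va u + y * dotp vb u) = dotp vb u * (x * qa + y * qb)
      + x * (dotp va u * qb - qa * dotp vb u) by ring.
    by rewrite E D0; ring.
  by rewrite xy mulr1.
have unitz (r : 'rV[R]_d) : r != 0 -> exists2 c, c != 0 & dotp (c *: r) (c *: r) = 1.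
  move=> /dotp_gt0 r0; exists (Num.sqrt (dotp r r))^-1.
    by rewrite invr_neq0 // sqrtr_eq0 -ltNge.
  rewrite dotpZl dotpZr mulrA -invfM -expr2 sqr_sqrtr ?ltW // mulVf // gt_eqF //.
have [ra0|ra0] := eqVneq (res va) 0; last first.
  have [c c0 cc] := unitz _ ra0; left; exists (c *: res va).
  have [y0|y0] := eqVneq y 0.
    case/eqP: ra0; move: rxy xy; rewrite y0 scale0r mul0r !addr0 => /eqP.
    by rewrite scaler_eq0 => /orP[/eqP ->|/eqP //]; rewrite mul0r => /eqP; rewrite eq_sym oner_eq0.
  apply: (main _ c^-1 (- (x / y) * c^-1)) => //.
  - by rewrite dotpZr res_u mulr0.
  - by rewrite scalerA mulVf // scale1r.
  - rewrite scalerA -mulrA mulVf // mulr1; apply: (scalerI y0).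
    rewrite scalerA mulrN mulrCA divff // mulr1 scaleNr.
    by apply/eqP; rewrite -addr_eq0 addrC rxy.
  - by rewrite invr_neq0.
have [rb0|rb0] := eqVneq (res vb) 0.
  right; exists (dotp va u), (dotp vb u); split => //.
    by rewrite {1}(vE va) ra0 addr0.
  by rewrite {1}(vE vb) rb0 addr0.
have [c c0 cc] := unitz _ rb0; left; exists (c *: res vb).
apply: (main _ 0 c^-1) => //.
- by rewrite dotpZr res_u mulr0.
- by rewrite scale0r.
- by rewrite scalerA mulVf // scale1r.
- by rewrite invr_neq0 ?orbT.
Qed.

(* [va / <va, rho> - vb / <vb, rho>] is the direction of the plane orthogonal to
   [rho]; it stays close to [u] because [<u, rho>] is not large compared to [<z, rho>]. *)
Lemma normalized_diff u z va vb rho i (y : 'I_d -> R) : plane_basis u z va vb ->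
  15 / 16 <= u 0 i ^+ 2 -> dotp va rho != 0 -> dotp vb rho != 0 ->
  dotp u rho ^+ 2 < 4 * dotp z rho ^+ 2 ->
  (forall k, y k = va 0 k / dotp va rho - vb 0 k / dotp vb rho) ->
  0 < \sum_k y k ^+ 2 <= 25 * y i ^+ 2.
Proof.
move=> [uu zz uz [p [q [p' [q' [vaE vbE D0]]]]]] ui A0 B0 XY yk.
set A := dotp va rho in A0 yk *; set B := dotp vb rho in B0 yk *.
set X := dotp z rho in XY; set Y := dotp u rho in XY.
pose yu := p / A - p' / B; pose yz := q / A - q' / B.
have yE k : y k = (yu *: u + yz *: z) 0 k.
  by rewrite yk vaE vbE !mxE /yu /yz; ring.
have AE : A = p * Y + q * X by rewrite /A vaE dotpDl !dotpZl.
have BE : B = p' * Y + q' * X by rewrite /B vbE dotpDl !dotpZl.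
have orth : yu * Y + yz * X = 0.
  have -> : yu * Y + yz * X = (p * Y + q * X) / A - (p' * Y + q' * X) / B by rewrite /yu /yz; ring.
  by rewrite -AE -BE !divff // subrr.
have yy : \sum_k y k ^+ 2 = yu ^+ 2 + yz ^+ 2.
  have -> : \sum_k y k ^+ 2 = dotp (yu *: u + yz *: z) (yu *: u + yz *: z).
    by apply: eq_bigr => k _; rewrite yE expr2.
  by rewrite !(dotpDl, dotpDr, dotpZl, dotpZr) uu zz uz (dotpC z u) uz; ring.
have X2 : 0 < X ^+ 2 by have := sqr_ge0 Y; lra.
have yz4 : yz ^+ 2 <= 4 * yu ^+ 2.
  rewrite -(ler_pM2r X2).
  have -> : yz ^+ 2 * X ^+ 2 = yu ^+ 2 * Y ^+ 2.
    have -> : yz ^+ 2 * X ^+ 2 = (yz * X) ^+ 2 by rewrite exprMn.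
    have -> : yz * X = - (yu * Y) by lra.
    by rewrite sqrrN exprMn.
  have := ler_wpM2l (sqr_ge0 yu) (ltW XY); lra.
have yu0 : 0 < yu ^+ 2.
  rewrite lt_def sqr_ge0 andbT; apply/eqP => yu0.
  have yz0 : yz ^+ 2 = 0 by apply/eqP; rewrite eq_le sqr_ge0 andbT; lra.
  move/eqP: yu0; rewrite sqrf_eq0 subr_eq0 => /eqP E1.
  move/eqP: yz0; rewrite sqrf_eq0 subr_eq0 => /eqP E2.
  have E1' : p = p' / B * A by rewrite -E1 mulfVK.
  have E2' : q = q' / B * A by rewrite -E2 mulfVK.
  by move/eqP: D0; apply; rewrite E1' E2'; ring.
have zi : z 0 i ^+ 2 <= 1 / 16 by have := bessel2 i uu zz uz; lra.
rewrite yy; apply/andP; split; first by have := sqr_ge0 yz; lra.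
have yi : y i = yu * u 0 i + yz * z 0 i by rewrite yE !mxE.
have h1 : 15 / 16 * yu ^+ 2 <= (yu * u 0 i) ^+ 2.
  by rewrite exprMn mulrC; apply: ler_wpM2l; rewrite ?sqr_ge0.
have h2 : (yz * z 0 i) ^+ 2 <= yu ^+ 2 / 4.
  rewrite exprMn; apply: le_trans (_ : (4 * yu ^+ 2) * (1 / 16) <= _); last by lra.
  by apply: ler_pM; rewrite ?sqr_ge0.
rewrite yi; set a := yu * _ in h1 *; set b := yz * _ in h2 *.
(* This gives [(a + b) ^+ 2 >= a ^+ 2 / 2 - b ^+ 2 >= 7 / 32 * yu ^+ 2], while the squared length is
   at most [5 * yu ^+ 2]; 25 times 7/32 exceeds 5. *)
have := sqr_ge0 (a + 2 * b); lra.
Qed.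

End DotProduct.

(** * Random sign vectors and a good direction *)

Section Rademacher.
Variable R : realType.

Definition rad d (f : 'I_d -> R) (xs : seq bool) : R :=
  \sum_k f k * bsign R (nth false xs k).

Lemma rad_cons d (f : 'I_d.+1 -> R) x xs :
  rad f (x :: xs) = f ord0 * bsign R x + rad (fun k => f (lift ord0 k)) xs.
Proof. by rewrite /rad big_ord_recl. Qed.

Lemma avg_rad2 d (f : 'I_d -> R) : avg d (fun xs => rad f xs ^+ 2) = \sum_k f k ^+ 2.
Proof.
elim: d f => [|d IH] f /=; first by rewrite /rad !big_ord0 expr0n.
rewrite big_ord_recl -IH -avgD mulrC -avgZ.
have {1}-> : f ord0 ^+ 2 = avg d (fun=> f ord0 ^+ 2) by rewrite avg_cst.
by rewrite -avgD; apply: eq_avg => xs _; rewrite !rad_cons /bsign; field.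
Qed.

Lemma avg_rad4_le d (f : 'I_d -> R) :
  avg d (fun xs => rad f xs ^+ 4) <= 3 * (\sum_k f k ^+ 2) ^+ 2.
Proof.
elim: d f => [|d IH] f /=; first by rewrite /rad !big_ord0 !expr0n /= mulr0.
set f' := fun k => f (lift ord0 k).
rewrite -avgD mulrC -avgZ.
have -> : avg d (fun xs => 2^-1 * (rad f (true :: xs) ^+ 4 + rad f (false :: xs) ^+ 4)) =
    f ord0 ^+ 4 + 6 * f ord0 ^+ 2 * avg d (fun xs => rad f' xs ^+ 2)
    + avg d (fun xs => rad f' xs ^+ 4).
  rewrite -avgZ -{1}(avg_cst d (f ord0 ^+ 4)) -!avgD; apply: eq_avg => xs _.
  by rewrite !rad_cons /bsign -/f'; field.
rewrite avg_rad2 big_ord_recl -/f'.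
have := IH f'; set q := \sum_k f' k ^+ 2.
have := sqr_ge0 (f ord0 ^+ 2); nra.
Qed.

(** A Paley-Zygmund argument: [F] has mean 3 and second moment at most [16 * 3 + 3 = 51], so it is
    positive with probability at least [9 / 51]. The pointwise bound used is
    [F <= 17 / 2 + F ^+ 2 / 34], that is [(F - 17) ^+ 2 >= 0]. *)
Lemma avg_ratio_ge d (f g : 'I_d -> R) :
  \sum_k f k ^+ 2 = 1 -> \sum_k g k ^+ 2 = 1 ->
  3 / 17 <= avg d (fun xs => (rad f xs ^+ 2 < 4 * rad g xs ^+ 2)%R%:R) :> R.
Proof.
move=> f1 g1.
pose F xs := 4 * rad g xs ^+ 2 - rad f xs ^+ 2.
have EF : avg d F = 3.
  rewrite /F avgD avgZ avg_rad2 g1.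
  under eq_avg do rewrite -mulN1r.
  by rewrite avgZ avg_rad2 f1; ring.
have EF2 : avg d (fun xs => F xs ^+ 2) <= 51.
  apply: le_trans (_ : avg d (fun xs => 16 * rad g xs ^+ 4 + rad f xs ^+ 4) <= _).
    apply: avg_le => xs _; rewrite /F.
    have : 0 <= rad g xs ^+ 2 * rad f xs ^+ 2 by rewrite mulr_ge0 ?sqr_ge0.
    lra.
  rewrite avgD avgZ.
  have := avg_rad4_le f; have := avg_rad4_le g; rewrite f1 g1 expr1n; lra.
have : avg d F <= avg d (fun xs => 17 / 2 * (rad f xs ^+ 2 < 4 * rad g xs ^+ 2)%R%:R + 1 / 34 * F xs ^+ 2).
  apply: avg_le => xs _; have F2 := sqr_ge0 (F xs).
  have := sqr_ge0 (F xs - 17); rewrite -subr_gt0 -/(F xs).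
  by case: ltP => /= h1 h2; lra.
rewrite EF avgD !avgZ; lra.
Qed.

Lemma avg_exists T (F : seq bool -> R) c : c <= avg T F -> exists xs, c <= F xs.
Proof.
elim: T F => [|T IH] F /= h; first by exists [::].
have [h1|h1] := leP c (avg T (fun xs => F (true :: xs))).
  by have [xs] := IH _ h1; exists (true :: xs).
have [|xs] := IH (fun xs => F (false :: xs)); first by lra.
by exists (false :: xs).
Qed.

(* A sign vector realising the average may be orthogonal to some [v j]; moving it
   slightly along the moment curve avoids this and keeps the strict inequalities. *)
Lemma direction_exists d (I J : finType) (P : pred I) (U Z : I -> 'rV[R]_d) (v : J -> 'rV[R]_d) :
  (forall i, P i -> dotp (U i) (U i) = 1 /\ dotp (Z i) (Z i) = 1) ->
  exists rho : 'rV[R]_d, (forall j, v j != 0 -> dotp (v j) rho != 0) /\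
    3 / 17 * #|P|%:R <=
      \sum_(i | P i) (dotp (U i) rho ^+ 2 < 4 * dotp (Z i) rho ^+ 2)%R%:R :> R.
Proof.
move=> UZ.
have sqE (u : 'rV[R]_d) : \sum_k u 0 k ^+ 2 = dotp u u.
  by apply: eq_bigr => k _; rewrite expr2.
have : 3 / 17 * #|P|%:R <= avg d (fun xs => \sum_(i | P i)
    (rad (fun k => U i 0 k) xs ^+ 2 < 4 * rad (fun k => Z i 0 k) xs ^+ 2)%R%:R) :> R.
  rewrite avg_sum mulr_natr -sumr_const; apply: ler_sum => i Pi.
  by have [u1 z1] := UZ _ Pi; apply: avg_ratio_ge; rewrite sqE.
move=> /avg_exists[xs hxs].
(* Distinct positive exponents keep every coordinate of [u] visible as a coefficient, while the
   constant term is the value at the sign vector. *)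
pose curve (u : 'rV[R]_d) : {poly R} :=
  \sum_k (u 0 k) *: ((bsign R (nth false xs k))%:P + 'X^(k.+1)).
pose rho t : 'rV[R]_d := \row_k (bsign R (nth false xs k) + t ^+ k.+1).
have curveE u t : (curve u).[t] = dotp u (rho t).
  rewrite /curve horner_sum; apply: eq_bigr => k _.
  by rewrite hornerZ hornerD hornerC hornerXn mxE.
have curve0 u : (curve u)`_0 = rad (fun k => u 0 k) xs.
  rewrite /curve coef_sum; apply: eq_bigr => k _.
  by rewrite coefZ coefD coefC coefXn /= addr0.
have curve_neq0 u : u != 0 -> curve u != 0.
  apply: contra_neq => c0; apply/rowP => k; rewrite mxE.
  have := congr1 (fun p : {poly R} => p`_k.+1) c0.
  rewrite coef0 /curve coef_sum (bigD1 k) //= big1 ?addr0 => [|j jk].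
    by rewrite coefZ coefD coefC coefXn eqxx /= add0r mulr1.
  rewrite coefZ coefD coefC coefXn /= add0r eqSS.
  by case: eqP => [/val_inj kj|_]; rewrite ?mulr0 //; rewrite kj eqxx in jk.
have [|e1 e10 h1] := @near0_all R _ (enum J) (fun j t => v j != 0 -> dotp (v j) (rho t) != 0).
  move=> j _; have [v0|v0] := eqVneq (v j) 0; first by exists 1.
  have [e e0 he] := horner_neq0_near0 (curve_neq0 _ v0).
  by exists e => // t te _; rewrite -curveE he.
have [|e2 e20 h2] := @near0_all R _ (enum I) (fun i t =>
   rad (fun k => U i 0 k) xs ^+ 2 < 4 * rad (fun k => Z i 0 k) xs ^+ 2 ->
   dotp (U i) (rho t) ^+ 2 < 4 * dotp (Z i) (rho t) ^+ 2).
  move=> i _; case: (ltP (rad (fun k => U i 0 k) xs ^+ 2)) => h; last by exists 1.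
  have [|e e0 he] := @horner_gt0_near0 R (4%:P * curve (Z i) * curve (Z i) - curve (U i) * curve (U i)).
    by rewrite coefB !coef0M coefC /= !curve0; lra.
  exists e => // t /andP[t0 te] _; have := he t; rewrite (ltW t0) te => /(_ isT).
  by rewrite hornerD hornerN !hornerM hornerC !curveE; lra.
pose t := Num.min e1 e2.
have t0 : 0 < t by rewrite lt_min e10.
exists (rho t); split.
  by move=> j; apply: h1; rewrite ?mem_enum // t0 ge_min lexx.
apply: le_trans hxs _; apply: ler_sum => i _.
case: ltP => // h; rewrite h2 ?mem_enum //.
by rewrite t0 ge_min lexx orbT.
Qed.

End Rademacher.

(** * Counting matched vertices *)

Section Counting.
Variables (R : realType) (n d : nat) (v : 'I_n -> 'rV[R]_d) (pr : 'I_d -> 'I_n -> 'I_n).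
Hypothesis prK : forall i, involutive (pr i).
Hypothesis decode : forall i a, pr i a != a -> exists x y u,
  [/\ u = x *: v a + y *: v (pr i a), dotp u u = 1 & 15 / 16 <= u 0 i ^+ 2].

Let heavy (i : 'I_d) a := dotp (v a) (v a) < 2 * v a 0 i ^+ 2.

(** Two coordinates cannot each carry more than half of the squared length. This limits the vertices
    lost to parallel pairs. *)
Let heavy_unique a : (\sum_i heavy i a <= 1)%N.
Proof.
case: (pickP (heavy^~ a)) => [i hi|h0]; last by rewrite big1 // => i _; rewrite h0.
rewrite (bigD1 i) //= hi big1 // => j ji; apply/eqP; rewrite eqb0; apply/negP => hj.
have : v a 0 i ^+ 2 + v a 0 j ^+ 2 <= dotp (v a) (v a).
  rewrite /dotp (bigD1 i) //= (bigD1 j) //= addrA -!expr2 lerDl.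
  by rewrite sumr_ge0 // => k _; rewrite -expr2 sqr_ge0.
by move: hi hj; rewrite /heavy; lra.
Qed.

Let transversal i a := `[< exists uz : 'rV[R]_d * 'rV[R]_d,
  plane_basis uz.1 uz.2 (v a) (v (pr i a)) /\ 15 / 16 <= uz.1 0 i ^+ 2 >].

(** In the parallel case at least one endpoint is a nonzero multiple of [u], and it is heavy because
    [15 / 16 > 1 / 2]. *)
Let active_cases i a : pr i a != a -> [|| transversal i a, heavy i a | heavy i (pr i a)].
Proof.
move=> /decode [x [y [u [uE uu ui]]]].
have [[z pb]|[ca [cb [va vb xy]]]] := plane_basis_or_parallel uE uu.
  by apply/orP; left; apply/asboolP; exists (u, z).
have hv b c : v b = c *: u -> c != 0 -> heavy i b.
  move=> vE c0; rewrite /heavy vE dotpZl dotpZr uu mxE exprMn mulr1 -expr2.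
  have c2 : 0 < c ^+ 2 by rewrite lt_def sqr_ge0 sqrf_eq0 c0.
  have := ler_wpM2l (ltW c2) ui; lra.
have [ca0|ca0] := eqVneq ca 0; last by rewrite (hv a ca) // orbT.
have cb0 : cb != 0.
  by apply/eqP => cb0; move/eqP: xy; rewrite ca0 cb0 !mulr0 addr0 eq_sym oner_eq0.
by rewrite (hv _ cb vb cb0) !orbT.
Qed.

(** Heavy endpoints account for at most [2 * n] incidences. Of the transversal ones a fraction 3/17
    becomes good for a suitable [rho], whence the factor 17/3 on [sum_good_le]. *)
Lemma sum_active_le : (0 < n)%N ->
  (\sum_i \sum_a (pr i a != a))%:R <=
    2 * n%:R + 17 / 3 * (64 * 60 ^+ 2 * n%:R * ln (n + n)%:R) :> R.
Proof.
move=> n0.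
have /choice[UZ hUZ] : forall ia : 'I_d * 'I_n, exists uz : 'rV[R]_d * 'rV[R]_d,
    transversal ia.1 ia.2 ->
    plane_basis uz.1 uz.2 (v ia.2) (v (pr ia.1 ia.2)) /\ 15 / 16 <= uz.1 0 ia.1 ^+ 2.
  move=> [i a] /=; case tr: (transversal i a); last by exists (0, 0).
  by have /asboolP[uz huz] := tr; exists uz.
pose P ia := transversal ia.1 ia.2.
have [|rho [vrho hrho]] := @direction_exists R d _ _ P (fun ia => (UZ ia).1) (fun ia => (UZ ia).2) v.
  by move=> ia /hUZ [[uu zz _ _] _].
pose w a k := v a 0 k / dotp (v a) rho.
pose q i a := \sum_k (w a k - w (pr i a) k) ^+ 2.
pose g i a := (0 < q i a) && (q i a <= 25 * (w a i - w (pr i a) i) ^+ 2).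
have g_pr i a : g i (pr i a) = g i a.
  rewrite /g prK -(opprB (w a i)) sqrrN.
  suff -> : q i (pr i a) = q i a by [].
  by apply: eq_bigr => k _; rewrite prK -(opprB (w a k)) sqrrN.
have hg : (\sum_i \sum_a g i a)%:R <= 64 * 60 ^+ 2 * n%:R * ln (n + n)%:R :> R.
  by apply: (@sum_good_le R n d w pr g) => // i a /andP[].
have cond_g : \sum_(ia | P ia) (dotp (UZ ia).1 rho ^+ 2 < 4 * dotp (UZ ia).2 rho ^+ 2)%R%:R
   <= (\sum_i \sum_a g i a)%:R :> R.
  rewrite pair_bigA /= natr_sum big_mkcond /=; apply: ler_sum => -[i a] _ /=.
  case: ifP => [tr|_]; last by rewrite ler0n.
  case: ltP => [XY|_]; last by rewrite ler0n.
  have [pb ui] := hUZ _ tr.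
  rewrite /= in pb ui XY.
  have [va0 vb0] := plane_basis_neq0 pb.
  have := @normalized_diff R d _ _ _ _ rho i (fun k => w a k - w (pr i a) k) pb ui
    (vrho _ va0) (vrho _ vb0) XY (fun=> erefl).
  by rewrite -/(g i a) => ->.
have cardP : #|P|%:R = (\sum_i \sum_a transversal i a)%:R :> R.
  by rewrite pair_bigA /= -sum1_card big_mkcond.
have act : (\sum_i \sum_a (pr i a != a) <= \sum_i \sum_a transversal i a + 2 * n)%N.
  have hn : (\sum_i \sum_a heavy i a <= n)%N.
    rewrite exchange_big /= -[X in (_ <= X)%N]card_ord -sum1_card.
    by apply: leq_sum => a _; apply: heavy_unique.
  have hn' : (\sum_i \sum_a heavy i (pr i a) <= n)%N.
    rewrite (eq_bigr (fun i => \sum_a heavy i a)%N) // => i _.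
    by rewrite [RHS](reindex_inj (inv_inj (prK i))).
  rewrite mul2n -addnn.
  apply: leq_trans (leq_add (leqnn _) (leq_add hn hn')).
  rewrite -!big_split /=; apply: leq_sum => i _.
  rewrite -!big_split /=; apply: leq_sum => a _.
  case: (boolP (pr i a != a)) => // /active_cases.
  by case: (transversal i a); case: (heavy i a); case: (heavy i (pr i a)).
move: act; rewrite -(ler_nat R) natrD natrM -cardP.
move: hrho cond_g hg; set S1 := \sum_(ia | P ia) _; lra.
Qed.

End Counting.

(** * Matchings *)

Section Partner.
Variables (T : finType) (P : {set {set T}}).
Hypothesis tP : trivIset P.
Hypothesis P2 : forall A : {set T}, A \in P -> #|A| = 2.

Definition partner (a : T) : T :=
  odflt a [pick b | (b != a) && ([set a; b] \in P)].

Lemma partner_edge a : partner a != a -> [set a; partner a] \in P.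
Proof.
rewrite /partner; case: pickP => [b /andP[] //|_] /=.
by rewrite eqxx.
Qed.

Lemma partner_unique a b : b != a -> [set a; b] \in P -> partner a = b.
Proof.
move=> ba abP; rewrite /partner; case: pickP => [c /andP[ca acP]|/(_ b)] /=; last by rewrite ba abP.
have E : [set a; c] = [set a; b].
  have := def_pblock tP acP (set21 a c); have := def_pblock tP abP (set21 a b).
  by move=> -> ->.
have : c \in [set a; b] by rewrite -E set22.
by rewrite !inE (negbTE ca) => /eqP.
Qed.

Lemma partnerK : involutive partner.
Proof.
move=> a; have [pa|pa] := eqVneq (partner a) a; first by rewrite !pa.
by apply: partner_unique; rewrite 1?eq_sym // setUC partner_edge.
Qed.

Lemma card_matching_le : (#|P| <= \sum_a (partner a != a))%N.
Proof.
have -> : (\sum_a (partner a != a) = #|[set a | partner a != a]|)%N.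
  by rewrite -sum1dep_card [RHS]big_mkcond; apply: eq_bigr => a _; case: (_ != _).
apply: leq_trans (_ : #|cover P| <= _)%N.
  rewrite -(eqP tP) -sum1_card; apply: leq_sum => A AP.
  by rewrite (P2 AP).
apply: subset_leq_card; apply/subsetP => a /bigcupP[A AP aA]; rewrite inE.
have /cards2P[x [y [xy E]]] : #|A| == 2 by rewrite (P2 AP).
move: aA AP; rewrite E !inE => xa AP; case/orP: xa => /eqP ->.
  by rewrite (partner_unique _ AP) // eq_sym.
by rewrite setUC in AP; rewrite (partner_unique _ AP).
Qed.

End Partner.

Lemma span_set2 (R : realType) (n d : nat) (v : 'I_n -> 'rV[R]_d) a b u :
  u \in <<[seq v j | j <- enum [set a; b]]>>%VS ->
  exists x y, u = x *: v a + y *: v b.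
Proof.
move=> us; have : u \in (<[v a]> + <[v b]>)%VS.
  apply: subvP us; apply/span_subvP => _ /mapP[j + ->].
  rewrite mem_enum !inE => /orP[]/eqP ->.
    by apply: (subvP (addvSl _ _)); apply: memv_line.
  by apply: (subvP (addvSr _ _)); apply: memv_line.
case/memv_addP => _ /vlineP[x ->] [_ /vlineP[y ->] ->].
by exists x, y.
Qed.

(** * From the weight threshold to the exponential lower bound *)

Lemma alpha0_sqr_ge (R : realType) (alpha : R) : alpha0 R < alpha -> 15 / 16 <= alpha ^+ 2.
Proof.
move=> h; have a0 : 0 <= alpha0 R by rewrite sqrtr_ge0.
(* The crude bound [pi >= 2] turns the threshold into [15 / 16]. *)
have p4 : 4 <= (pi : R) ^+ 2.
  by have := pi_ge2 R; have := pi_gt0 R; nra.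
have p16 : 1 / (4 * pi ^+ 2) <= 1 / 16 :> R.
  by rewrite !div1r lef_pV2 ?posrE; lra.
have : alpha0 R ^+ 2 = 1 - 1 / (4 * pi ^+ 2) by rewrite sqr_sqrtr //; lra.
have : alpha0 R ^+ 2 <= alpha ^+ 2 by rewrite lerXn2r ?nnegrE // ltW // (le_lt_trans a0).
lra.
Qed.

Lemma weight_unit (R : realType) (d : nat) (u : 'rV[R]_d) (i : 'I_d) (alpha : R) :
  u != 0 -> 15 / 16 <= alpha ^+ 2 -> 0 <= alpha -> alpha <= weight i u ->
  exists2 c, dotp (c *: u) (c *: u) = 1 & 15 / 16 <= (c *: u) 0 i ^+ 2.
Proof.
move=> u0 a2 a0; rewrite /weight dotp_delta /norm2 => h.
have uu := dotp_gt0 u0.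
exists (Num.sqrt (dotp u u))^-1.
  by rewrite dotpZl dotpZr mulrA -invfM -expr2 sqr_sqrtr ?ltW // mulVf // gt_eqF.
apply: le_trans a2 _; rewrite mxE mulrC.
rewrite -[leRHS](@real_normK _ (_ / _)) ?num_real // normrM.
rewrite [X in _ * X]ger0_norm ?invr_ge0 ?sqrtr_ge0 //.
by rewrite lerXn2r // nnegrE // (le_trans a0).
Qed.

Lemma LDC_delta_le (R : realType) (alpha delta : R) (n d : nat)
    (v : 'I_n -> 'rV[R]_d) (M : 'I_d -> {set {set 'I_n}}) :
  15 / 16 <= alpha ^+ 2 -> 0 <= alpha -> (0 < n)%N ->
  approx_LDC 2 alpha delta v M ->
  delta * d%:R <= 2 + 17 / 3 * (64 * 60 ^+ 2 * ln (n + n)%:R).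
Proof.
move=> a2 a0 n0 [Mm Mu Md].
pose pr i := partner (M i).
have n0' : 0 < n%:R :> R by rewrite ltr0n.
rewrite -(ler_pM2r n0'); apply: le_trans Md _.
apply: le_trans (_ : (\sum_i \sum_a (pr i a != a))%:R <= _).
  by rewrite ler_nat; apply: leq_sum => i _; have [tM M2] := Mm i; apply: card_matching_le.
have := @sum_active_le R n d v pr.
have -> : 2 * n%:R + 17 / 3 * (64 * 60 ^+ 2 * n%:R * ln (n + n)%:R) =
  (2 + 17 / 3 * (64 * 60 ^+ 2 * ln (n + n)%:R)) * n%:R :> R by ring.
apply => //.
  by move=> i; have [tM _] := Mm i; apply: partnerK.
move=> i a pa; have [u [us u0 uw]] := Mu _ _ (partner_edge pa).
have [c cc ci] := weight_unit u0 a2 a0 uw.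
have [x [y uE]] := span_set2 us.
by exists (c * x), (c * y), (c *: u); split => //; rewrite uE scalerDr !scalerA.
Qed.

Theorem theorem2 (R : realType) (alpha : R)
    (halpha0 : alpha0 R < alpha) (halpha1 : alpha <= 1) :
  exists c : R, 0 < c /\
    forall (d n : nat) (delta : R) (v : 'I_n -> 'rV[R]_d)
      (M : 'I_d -> {set {set 'I_n}}),
      (0 < d)%N -> (0 < n)%N -> 0 <= delta -> delta <= 1 ->
      approx_LDC 2 alpha delta v M ->
      2 `^ (c * delta * d%:R) <= n%:R.
Proof.
have a2 := alpha0_sqr_ge halpha0.
have a0 : 0 <= alpha by apply: le_trans (ltW halpha0); rewrite sqrtr_ge0.
pose C : R := 17 / 3 * (64 * 60 ^+ 2).
have C0 : 0 < C by rewrite /C; lra.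
(* For [n >= 2], [2 <= 4 * ln 2 <= 4 * ln n] and [ln (2 * n) <= 2 * ln n] absorb the additive
   terms. *)
exists (4 + 2 * C)^-1; split; first by rewrite invr_gt0; lra.
move=> d n delta v M d0 n0 dl0 _ ldc.
have ln2 : 1 / 2 <= ln 2 :> R.
  have : ln (1 + - (1 / 2)) <= - (1 / 2) :> R by apply: le_ln1Dx; lra.
  have -> : 1 + - (1 / 2) = 2^-1 :> R by field.
  by rewrite lnV ?posrE; lra.
have ln2' : ln 2 <= 1 :> R.
  have : ln (1 + 1) <= 1 :> R by apply: le_ln1Dx; lra.
  by [].
have dd0 : 0 <= delta * d%:R by rewrite mulr_ge0 ?ler0n.
have key : delta * d%:R <= (4 + 2 * C) * ln n%:R.
  (* For [n = 1] the logarithm vanishes, but there is no two-element subset, so all matchings are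
     empty and [delta * d <= 0]. *)
  have [n1|n1] := leqP n 1.
    have nE : n%:R = 1 :> R by apply/eqP; rewrite pnatr_eq1 eqn_leq n1.
    case: ldc => Mm _; rewrite nE ln1 mulr0 mulr1 big1 // => i _.
    apply/eqP; rewrite cards_eq0; apply/set0Pn => -[A /(proj2 (Mm i)) A2].
    by have := max_card (mem A); rewrite A2 card_ord leqNgt ltnS n1.
  have := LDC_delta_le a2 a0 n0 ldc.
  have nn : 0 < n%:R :> R by rewrite ltr0n.
  have l2n : ln 2 <= ln n%:R :> R by rewrite ler_ln ?posrE // ler_nat.
  rewrite addnn -mul2n natrM lnM ?posrE //.
  move=> h; apply: le_trans h _.
  have -> : 17 / 3 * (64 * 60 ^+ 2 * (ln 2%:R + ln n%:R)) = C * (ln 2 + ln n%:R) :> R.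
    by rewrite /C; ring.
  have : C * ln 2 <= C * ln n%:R by rewrite ler_wpM2l // ltW.
  lra.
have nn : 0 < n%:R :> R by rewrite ltr0n.
rewrite -ler_ln ?posrE ?powR_gt0 // ln_powR -(mulrA _ delta).
apply: le_trans (_ : (4 + 2 * C)^-1 * (delta * d%:R) <= _).
  by rewrite ler_piMr // mulr_ge0 // invr_ge0; lra.
by rewrite ler_pdivrMl //; lra.
Qed.
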